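(* Among the positive integers $n$, $\overline{b}_5(n)$ is $0$ for at least $30\%$, greater than $0$ for at least $52\%$, and less than $0$ for at least $10\%$. That is, $$\liminf_{N\to\infty}\frac{\#\{1\le n\le N:\overline{b}_5(n)=0\}}{N}\ge \frac{30}{100},\qquad \liminf_{N\to\infty}\frac{\#\{1\le n\le N:\overline{b}_5(n)>0\}}{N}\ge \frac{52}{100},$$ $$\liminf_{N\to\infty}\frac{\#\{1\le n\le N:\overline{b}_5(n)<0\}}{N}\ge \frac{10}{100}.$$
   Context: For $j\ge1$ let $f_j:=\prod_{k\ge 1}(1-q^{jk})$ (for $|q|<1$, or as a formal power series). Let $\psi(-q):=\sum_{n=0}^{\infty}(-q)^{n(n+1)/2}=f_1f_4/f_2$, so that $\psi(-q^5)=f_5f_{20}/f_{10}$. The integers $\overline{b}_5(n)$ are defined by $$\sum_{n=0}^\infty \overline{b}_5(n)q^n=\frac{\psi^5(-q^5)}{\psi(-q)}=1+q+q^2+2q^3+3q^4-q^5+2q^7-2q^9+6q^{10}+\cdots .$$ Percentages of positive integers are understood in the sense of (lower) asymptotic density. *)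

(* Defs.v *)
From mathcomp Require Import all_boot all_order all_algebra.
From mathcomp Require Import all_classical all_reals all_analysis.

Set Implicit Arguments.
Unset Strict Implicit.
Unset Printing Implicit Defensive.

Import Order.TTheory GRing.Theory Num.Theory.
Local Open Scope ring_scope.

(* Formal power series in q over the integers: [a n] is the coefficient of
   q^n. *)
Definition fps := nat -> int.

Definition fps_one : fps := fun n => (n == 0%N)%:R.

Definition fps_mul (a b : fps) : fps :=
  fun n => \sum_(i < n.+1) a i * b (n - i)%N.

Definition fps_exp (a : fps) (k : nat) : fps := iter k (fps_mul a) fps_one.

(* a(q) |-> a(q^k), for k > 0. *)
Definition fps_subX (k : nat) (a : fps) : fps :=
  fun n => if (k %| n)%N then a (n %/ k)%N else 0.

(* First n coefficients of a/b when b has constant term 1, obtained by solving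
   c_n + \sum_(i < n) c_i b_(n - i) = a_n. *)
Fixpoint fps_div_seq (a b : fps) (n : nat) : seq int :=
  if n is m.+1 then
    let s := fps_div_seq a b m in
    rcons s (a m - \sum_(i < m) s`_i * b (m - i)%N)
  else [::].

(* The quotient a/b; only meaningful when b has constant term 1 (see
   [fps_divK] and [fps_div_uniq]). *)
Definition fps_div (a b : fps) : fps := fun n => (fps_div_seq a b n.+1)`_n.

(* psi(-q) = \sum_(n >= 0) (-q)^(n(n+1)/2); only the n <= m can contribute to
   the coefficient of q^m, as n <= n(n+1)/2. *)
Definition psiN : fps :=
  fun m => \sum_(n < m.+1 | (n * n.+1)./2 == m) (-1) ^+ (n * n.+1)./2.

(* \sum_n bbar5 n q^n = psi(-q^5)^5 / psi(-q). *)
Definition bbar5 : nat -> int := fps_div (fps_exp (fps_subX 5 psiN) 5) psiN.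

(* #{1 <= n <= N : P n} / N, with value 0 at N = 0. *)
Definition proportion (R : realType) (P : pred nat) (N : nat) : R :=
  (count P (iota 1 N))%:R / N%:R.

Definition lower_density (R : realType) (P : pred nat) : \bar R :=
  limn_einf (fun N => (proportion R P N)%:E).

Lemma size_fps_div_seq a b n : size (fps_div_seq a b n) = n.
Proof. by elim: n => //= n IHn; rewrite size_rcons IHn. Qed.

Lemma nth_fps_div_seq a b n i :
  (i < n)%N -> (fps_div_seq a b n)`_i = fps_div a b i.
Proof.
elim: n => // n IHn; rewrite ltnS leq_eqVlt => /predU1P[-> //|lt_in].
by rewrite /= nth_rcons size_fps_div_seq lt_in IHn.
Qed.

Lemma fps_div_rec a b n :
  fps_div a b n = a n - \sum_(i < n) fps_div a b i * b (n - i)%N.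
Proof.
rewrite {1}/fps_div /= nth_rcons size_fps_div_seq ltnn eqxx.
by congr (_ - _); apply: eq_bigr => i _; rewrite nth_fps_div_seq.
Qed.

Lemma fps_divK a b : b 0%N = 1 -> fps_mul (fps_div a b) b =1 a.
Proof.
move=> b0 n; rewrite /fps_mul big_ord_recr /= subnn b0 mulr1 addrC.
by rewrite fps_div_rec subrK.
Qed.

Lemma fps_div_uniq a b c : b 0%N = 1 -> fps_mul c b =1 a -> c =1 fps_div a b.
Proof.
move=> b0 cb n; elim/ltn_ind: n => n IHn.
rewrite fps_div_rec -cb /fps_mul big_ord_recr /= subnn b0 mulr1.
rewrite (eq_bigr (fun i : 'I_n => fps_div a b i * b (n - i)%N)).
  by rewrite addrAC subrr add0r.
by move=> i _; rewrite IHn.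
Qed.

Lemma psiN0 : psiN 0 = 1.
Proof. by rewrite /psiN big_mkcond big_ord_recl big_ord0. Qed.

Lemma bbar5P : fps_mul bbar5 psiN =1 fps_exp (fps_subX 5 psiN) 5.
Proof. exact: fps_divK psiN0. Qed.

(* Main.v *)
(** Put b'(n) = (-1)^n bbar5(n), so that F = \sum b'(n) q^(n+3) is
    q^3 psi(q^5)^5 / psi(q), and let C = \sum_m q^m \sum_(d | m) chi(m/d) d and
    E = \sum_m q^m \sum_(d | m) chi(d) d for the Legendre symbol chi modulo 5.
    The heart of the proof is 4 F(q) = C(q) - 3 C(q^2) - E(q) + E(q^2).

    Multiplication by 2 + i on Gaussian integers gives quadratic theta
    identities relating psi(q)^2 to psi(q^5)^2, phi(-q)^2 to phi(-q^5)^2, and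
    f_1^6 to the Wronskian of A = f(-q^2,-q^3) and B = f(-q,-q^4).  Since AB and
    the logarithmic derivatives of A and B are read off the triple product, the
    Wronskian identity says that 1 - 5 E = f_1^5 / f_5.  For a primitive fifth
    root of unity z, the products of (1-q^i)(1-z q^i)(1-q^i/z) are combinations
    of A(q^5) and q B(q^5), so the same identity at q^5 gives C = q f_5^5 / f_1.
    The formula for F then follows algebraically from the other two identities.

    For m = n + 3 = 2^a N with N odd, the coefficient of F is an explicit
    combination of the coefficients c > 0 of C and e of E at N, where e = chi(N) c
    if 5 does not divide N and |e| < c otherwise.  The resulting sign depends
    only on residue classes, and those of modulus 1600 already suffice. *)

From HB Require Import structures.
Require Import Defs.
From mathcomp Require Import all_boot all_order all_algebra.
From mathcomp Require Import all_field finmap.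
From mathcomp Require Import all_classical all_reals all_analysis.
From mathcomp Require Import ring zify.

Set Implicit Arguments.
Unset Strict Implicit.
Unset Printing Implicit Defensive.

Import Order.TTheory GRing.Theory Num.Theory.
Local Open Scope ring_scope.

(** * Formal power series *)

(** Series are coefficient sequences, and infinite products and sums are handled through congruences
    modulo q^n, so every limit is a statement about finitely many factors.

    The triple product is needed with z a power of q (theta series) and with z a constant (1, -1 and
    fifth roots of unity). Its quotient by 1 - z covers both cases: it depends on z only through S =
    p (z + 1/z), hence stays inside power series, and at z = 1 it gives Jacobi's series for f_1^3
    without a limit.

    The Wronskian identity is used at two levels. Over q it yields E. Over q^5 it yields C, because
    the triple products at z and z^2, for z a primitive fifth root of unity, are combinations of the
    same two series A(q^5) and q B(q^5).

    What makes the last algebraic step possible is that the two remaining quadratic identities share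
    the unknowns f_1 and f_5: eliminating these leaves one polynomial relation between f_2/f_1,
    f_10/f_5 and q, and the formula for F is a consequence of it. *)

Definition ps (K : Type) := nat -> K.

Section PowerSeries.
Variable K : comNzRingType.
Implicit Types (f g h : ps K) (n : nat).

HB.instance Definition _ := gen_eqMixin (ps K).
HB.instance Definition _ := gen_choiceMixin (ps K).

Definition ps_add f g : ps K := fun n => f n + g n.
Definition ps_opp f : ps K := fun n => - f n.
Definition ps_mul f g : ps K := fun n => \sum_(i < n.+1) f i * g (n - i)%N.
Definition psC (c : K) : ps K := fun n => c *+ (n == 0%N).

Fact ps_addA : associative ps_add.
Proof. by move=> f g h; apply/funext => n; rewrite /ps_add addrA. Qed.
Fact ps_addC : commutative ps_add.
Proof. by move=> f g; apply/funext => n; rewrite /ps_add addrC. Qed.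
Fact ps_add0 : left_id (fun=> 0) ps_add.
Proof. by move=> f; apply/funext => n; rewrite /ps_add add0r. Qed.
Fact ps_addN : left_inverse (fun=> 0) ps_opp ps_add.
Proof. by move=> f; apply/funext => n; rewrite /ps_add /ps_opp addNr. Qed.

HB.instance Definition _ :=
  GRing.isZmodule.Build (ps K) ps_addA ps_addC ps_add0 ps_addN.

(** The ring laws of the Cauchy product are inherited from polynomials: its coefficient n only sees
    the truncations at n + 1. *)
Definition ps_trunc n f : {poly K} := \poly_(i < n) f i.

Lemma coef_trunc_mul n i f g : (i < n)%N ->
  (ps_trunc n f * ps_trunc n g)`_i = ps_mul f g i.
Proof.
move=> lt_in; rewrite coefM; apply: eq_bigr => j _.
rewrite !coef_poly (leq_ltn_trans (leq_ord j) lt_in).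
by rewrite (leq_ltn_trans (leq_subr _ _) lt_in).
Qed.

Fact ps_mulA : associative ps_mul.
Proof.
move=> f g h; apply/funext => n.
transitivity ((ps_trunc n.+1 f * (ps_trunc n.+1 g * ps_trunc n.+1 h))`_n).
  rewrite coefM; apply: eq_bigr => j _; rewrite coef_poly ltn_ord.
  by rewrite coef_trunc_mul // ltnS leq_subr.
rewrite mulrA coefM; apply: eq_bigr => j _.
by rewrite coef_trunc_mul // coef_poly ltnS leq_subr.
Qed.

Fact ps_mulC : commutative ps_mul.
Proof.
move=> f g; apply/funext => n.
by rewrite -!(@coef_trunc_mul n.+1) // mulrC.
Qed.

Fact ps_mul1 : left_id (psC 1) ps_mul.
Proof.
move=> f; apply/funext => n; rewrite /ps_mul big_ord_recl /= mul1r subn0.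
by rewrite big1 ?addr0 // => i _; rewrite /psC /= mul0r.
Qed.

Fact ps_mulDl : left_distributive ps_mul ps_add.
Proof.
move=> f g h; apply/funext => n; rewrite /ps_add /ps_mul -big_split /=.
by apply: eq_bigr => i _; rewrite mulrDl.
Qed.

Fact ps_oner_neq0 : psC 1 != (0 : ps K).
Proof.
apply/eqP => /(congr1 (fun f : ps K => f 0%N)) /eqP.
by rewrite /psC /= mulr1n oner_eq0.
Qed.

HB.instance Definition _ := GRing.Zmodule_isComNzRing.Build (ps K)
  ps_mulA ps_mulC ps_mul1 ps_mulDl ps_oner_neq0.

Lemma psD f g n : (f + g) n = f n + g n. Proof. by []. Qed.
Lemma psN f n : (- f) n = - f n. Proof. by []. Qed.
Lemma psB f g n : (f - g) n = f n - g n. Proof. by []. Qed.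
Lemma psM f g n : (f * g) n = \sum_(i < n.+1) f i * g (n - i)%N.
Proof. by []. Qed.
Lemma ps0 n : (0 : ps K) n = 0. Proof. by []. Qed.
Lemma ps1 n : (1 : ps K) n = (n == 0%N)%:R. Proof. by []. Qed.
Lemma psM0 f g : (f * g) 0%N = f 0%N * g 0%N.
Proof. by rewrite psM big_ord_recl big_ord0 addr0. Qed.

Lemma ps_sum (I : Type) (r : seq I) (P : pred I) (F : I -> ps K) n :
  (\sum_(i <- r | P i) F i) n = \sum_(i <- r | P i) F i n.
Proof. by elim/big_rec2: _ => // i y x _ <-. Qed.

Fact psC_is_additive : {morph psC : a b / a + b}.
Proof. by move=> a b; apply/funext => n; rewrite psD /psC mulrnDl. Qed.

Lemma psCD a b : psC (a + b) = psC a + psC b. Proof. exact: psC_is_additive. Qed.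
Lemma psC0 : psC 0 = 0. Proof. by apply/funext => n; rewrite /psC mul0rn. Qed.
Lemma psC1 : psC 1 = 1. Proof. by []. Qed.
Lemma psCN a : psC (- a) = - psC a.
Proof. by apply/funext => n; rewrite psN /psC mulNrn. Qed.
Lemma psCM_coef a f n : (psC a * f) n = a * f n.
Proof.
rewrite psM big_ord_recl /= subn0 /psC mulr1n big1 ?addr0 // => i _.
by rewrite mul0r.
Qed.
Lemma psCM a b : psC (a * b) = psC a * psC b.
Proof. by apply/funext => n; rewrite psCM_coef /psC mulrnAr. Qed.
Lemma psC_nat k : psC k%:R = k%:R.
Proof. by elim: k => [|k IHk]; rewrite ?psC0 // !mulrS psCD IHk. Qed.
Lemma psMn f k n : (f *+ k) n = f n *+ k.
Proof. by elim: k => [|k IHk] //; rewrite !mulrS psD IHk. Qed.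

Definition qX n : ps K := fun m => (m == n)%:R.

Lemma qXM n f m : (qX n * f) m = if (n <= m)%N then f (m - n)%N else 0.
Proof.
rewrite psM; case: leqP => [le_nm|lt_mn]; last first.
  rewrite big1 // => i _; rewrite /qX ltn_eqF ?mul0r //.
  exact: leq_ltn_trans (leq_ord i) lt_mn.
rewrite (bigD1 (inord n)) //= inordK ?ltnS // /qX eqxx mul1r big1 ?addr0 //.
move=> i ni; case: eqP => [e|]; last by rewrite mul0r.
by case/eqP: ni; apply: val_inj; rewrite /= inordK ?ltnS.
Qed.

Lemma qXD m n : qX (m + n) = qX m * qX n.
Proof.
apply/funext => k; rewrite qXM /qX.
case: leqP => [le_mk|lt_km]; first by congr (nat_of_bool _)%:R; lia.
by rewrite ltn_eqF // ltn_addr.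
Qed.

Lemma qXn m n : qX m ^+ n = qX (m * n).
Proof.
by elim: n => [|n IHn]; rewrite ?muln0 ?expr0 // exprS IHn -qXD mulnS.
Qed.

(** * Congruence of power series modulo q^n *)

Definition eqmod n f g := forall i, (i < n)%N -> f i = g i.

Lemma eqmod_sym n f g : eqmod n f g -> eqmod n g f.
Proof. by move=> fg i /fg. Qed.
Lemma eqmod_trans n g f h : eqmod n f g -> eqmod n g h -> eqmod n f h.
Proof. by move=> fg gh i lt_in; rewrite fg ?gh. Qed.
Lemma eqmodW m n f g : (m <= n)%N -> eqmod n f g -> eqmod m f g.
Proof. by move=> le_mn fg i lt_im; apply: fg; apply: leq_trans le_mn. Qed.
Lemma eqmod_eq f g : (forall n, eqmod n f g) -> f = g.
Proof. by move=> fg; apply/funext => n; apply: (fg n.+1). Qed.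
Lemma eqmodD n f g f' g' :
  eqmod n f f' -> eqmod n g g' -> eqmod n (f + g) (f' + g').
Proof. by move=> ff' gg' i lt_in; rewrite !psD ff' ?gg'. Qed.
Lemma eqmodN n f f' : eqmod n f f' -> eqmod n (- f) (- f').
Proof. by move=> ff' i lt_in; rewrite !psN ff'. Qed.
Lemma eqmodB n f g f' g' :
  eqmod n f f' -> eqmod n g g' -> eqmod n (f - g) (f' - g').
Proof. by move=> ff' gg'; apply: eqmodD => //; apply: eqmodN. Qed.
Lemma eqmodM n f g f' g' :
  eqmod n f f' -> eqmod n g g' -> eqmod n (f * g) (f' * g').
Proof.
move=> ff' gg' i lt_in; rewrite !psM; apply: eq_bigr => j _.
rewrite ff' ?gg' //; first by apply: leq_ltn_trans (leq_subr _ _) lt_in.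
exact: leq_ltn_trans (leq_ord j) lt_in.
Qed.
Lemma eqmod_sum n (I : Type) (r : seq I) (P : pred I) (F G : I -> ps K) :
  (forall i, P i -> eqmod n (F i) (G i)) ->
  eqmod n (\sum_(i <- r | P i) F i) (\sum_(i <- r | P i) G i).
Proof.
by move=> FG; elim/big_rec2: _ => // i x y Pi xy; apply: eqmodD => //; apply: FG.
Qed.
Lemma eqmod_prod1 n (I : Type) (r : seq I) (P : pred I) (F : I -> ps K) :
  (forall i, P i -> eqmod n (F i) 1) -> eqmod n (\prod_(i <- r | P i) F i) 1.
Proof.
move=> F1; elim/big_rec: _ => // i x Pi x1; rewrite -[1]mulr1.
by apply: eqmodM => //; apply: F1.
Qed.

Lemma eqmod0M m n f g : eqmod m f 0 -> eqmod n g 0 -> eqmod (m + n) (f * g) 0.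
Proof.
move=> f0 g0 i lt_i; rewrite psM ps0 big1 // => j _.
have [lt_jm|le_mj] := ltnP j m; first by rewrite f0 // mul0r.
rewrite g0 ?mulr0 //; have := ltn_ord j; lia.
Qed.
Lemma eqmod0Ml n f g : eqmod n f 0 -> eqmod n (f * g) 0.
Proof. by move=> f0; rewrite -[n]addn0; apply: eqmod0M. Qed.
Lemma eqmod0Mr n f g : eqmod n g 0 -> eqmod n (f * g) 0.
Proof. by move=> g0; rewrite mulrC; apply: eqmod0Ml. Qed.
Lemma eqmod_qX n m : (m <= n)%N -> eqmod m (qX n) 0.
Proof. by move=> le_mn i lt_im; rewrite /qX ltn_eqF // (leq_trans lt_im). Qed.

(* f(q) |-> f(q^k), for k > 0. *)
Definition psub (k : nat) f : ps K :=
  fun n => if (k %| n)%N then f (n %/ k)%N else 0.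

Lemma psubE k f n : (0 < k)%N -> psub k f (k * n)%N = f n.
Proof. by move=> k_gt0; rewrite /psub dvdn_mulr // mulKn. Qed.

Lemma psub_inj k : (0 < k)%N -> injective (psub k).
Proof.
move=> k_gt0 f g e; apply/funext => n.
by rewrite -(psubE f n k_gt0) e psubE.
Qed.

Lemma psubD k f g : psub k (f + g) = psub k f + psub k g.
Proof. by apply/funext => n; rewrite psD /psub; case: ifP; rewrite ?addr0. Qed.
Lemma psubN k f : psub k (- f) = - psub k f.
Proof. by apply/funext => n; rewrite psN /psub; case: ifP; rewrite ?oppr0. Qed.
Lemma psubB k f g : psub k (f - g) = psub k f - psub k g.
Proof. by rewrite psubD psubN. Qed.
Lemma psubC k c : (0 < k)%N -> psub k (psC c) = psC c.
Proof.
move=> k_gt0; apply/funext => n; rewrite /psub /psC.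
case: ifPn => [/dvdnP[m ->]|]; first by rewrite mulnK // muln_eq0 [k == 0%N]gtn_eqF ?orbF.
by case: n => [|n _]; rewrite ?dvdn0.
Qed.
Lemma psub1 k : (0 < k)%N -> psub k 1 = 1. Proof. exact: psubC. Qed.

Lemma psub_qX k n : (0 < k)%N -> psub k (qX n) = qX (k * n).
Proof.
move=> k_gt0; apply/funext => m; rewrite /psub /qX.
case: ifPn => [/dvdnP[j ->]|ndiv]; first by rewrite mulnK // mulnC eqn_pmul2l.
by case: eqP => // e; rewrite e dvdn_mulr in ndiv.
Qed.

Lemma psubM k f g : (0 < k)%N -> psub k (f * g) = psub k f * psub k g.
Proof.
move=> k_gt0; apply/funext => n; rewrite {1}/psub.
case: ifPn => [/dvdnP[m ->{n}]|ndiv]; last first.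
  rewrite psM big1 // => i _; rewrite /psub.
  case: ifPn => [di|]; last by rewrite mul0r.
  case: ifPn => [dni|]; last by rewrite mulr0.
  by case/negP: ndiv; rewrite -(subnKC (leq_ord i)) dvdn_add.
rewrite mulnK // !psM; apply/esym.
rewrite (bigID (fun i : 'I__ => (k %| i)%N)) /= [X in _ + X]big1 ?addr0; last first.
  by move=> i /negbTE ni; rewrite /psub ni mul0r.
rewrite (reindex_onto (fun i : 'I_m.+1 => inord (i * k) : 'I_(m * k).+1)
                      (fun i : 'I_(m * k).+1 => inord (i %/ k))) /=; last first.
  move=> i /dvdnP[j ej]; apply: val_inj => /=; rewrite ej mulnK //.
  have lej : (j <= m)%N by rewrite -(leq_pmul2r k_gt0) -ej leq_ord.
  by rewrite inordK inordK ?ltnS //= ?leq_mul2r ?lej ?orbT.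
apply: eq_big => [i|i _].
  have lei : (i * k < (m * k).+1)%N by rewrite ltnS leq_mul2r leq_ord orbT.
  rewrite inordK // dvdn_mull //= mulnK //.
  by apply/eqP; apply: val_inj; rewrite /= inordK.
have lei : (i * k < (m * k).+1)%N by rewrite ltnS leq_mul2r leq_ord orbT.
by rewrite inordK // -mulnBl ![(_ * k)%N]mulnC !psubE.
Qed.

Lemma psubX k f n : (0 < k)%N -> psub k (f ^+ n) = psub k f ^+ n.
Proof.
move=> k_gt0; elim: n => [|n IHn]; first by rewrite !expr0 psub1.
by rewrite !exprS psubM // IHn.
Qed.

Lemma psub_psub j k f : (0 < j)%N -> (0 < k)%N ->
  psub j (psub k f) = psub (j * k) f.
Proof.
move=> j0 k0; apply/funext => n; rewrite /psub.
case: ifPn => [/dvdnP[m ->]|ndiv]; last first.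
  by case: ifPn => // /(dvdn_trans (dvdn_mulr k (dvdnn j))); rewrite (negbTE ndiv).
by rewrite mulnK // [(m * j)%N]mulnC dvdn_pmul2l // divnMl.
Qed.

(* The derivation q d/dq. *)
Definition pder f : ps K := fun n => f n *+ n.

Lemma pderD f g : pder (f + g) = pder f + pder g.
Proof. by apply/funext => n; rewrite psD /pder mulrnDl. Qed.
Lemma pderN f : pder (- f) = - pder f.
Proof. by apply/funext => n; rewrite psN /pder mulNrn. Qed.
Lemma pderM f g : pder (f * g) = pder f * g + f * pder g.
Proof.
apply/funext => n; rewrite psD /pder !psM -sumrMnl -big_split /=.
apply: eq_bigr => i _; rewrite mulrnAl mulrnAr -mulrnDr subnKC //.
exact: leq_ord.
Qed.
Lemma pder_C c : pder (psC c) = 0.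
Proof. by apply/funext => -[|n]; rewrite /pder /psC ?mulr0n ?mul0rn. Qed.
Lemma pder_CM c f : pder (psC c * f) = psC c * pder f.
Proof. by rewrite pderM pder_C mul0r add0r. Qed.
Lemma pder_qX n : pder (qX n) = qX n *+ n.
Proof.
apply/funext => m; rewrite psMn /pder /qX; case: eqP => [->|] //.
by rewrite !mul0rn.
Qed.
Lemma pder_sub k f : (0 < k)%N -> pder (psub k f) = psub k (pder f) *+ k.
Proof.
move=> k_gt0; apply/funext => n; rewrite psMn /pder /psub.
case: ifPn => [/dvdnP[m ->]|]; last by rewrite !mul0rn.
by rewrite mulnK // mulrnA.
Qed.
Lemma eqmod_pder n f g : eqmod n f g -> eqmod n (pder f) (pder g).
Proof. by move=> fg i lt_in; rewrite /pder fg. Qed.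

End PowerSeries.

Arguments qX {K}.

Section PowerSeriesDomain.
Variable K : idomainType.
Implicit Types f g h : ps K.

(** Let f_m be the lowest nonzero coefficient of f. If g vanishes below n, then coefficient m + n of
    f g is f_m g_n. *)
Lemma ps_mulf_eq0 f g : f * g = 0 -> f != 0 -> g = 0.
Proof.
move=> fg0 f_neq0.
have exf : exists n, f n != 0.
  apply/not_existsP => f0; case/eqP: f_neq0; apply/funext => n.
  by have /negP := f0 n; rewrite negbK => /eqP.
have [m fm min_m] := ex_minnP exf.
apply/funext => n; rewrite ps0; elim/ltn_ind: n => n IHn.
have /(congr1 (fun h : ps K => h (m + n)%N)) := fg0.
rewrite psM ps0.
have lt_m : (m < (m + n).+1)%N by rewrite ltnS leq_addr.
rewrite (bigD1 (Ordinal lt_m)) //= addKn big1 ?addr0.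
  by move/eqP; rewrite mulf_eq0 (negbTE fm) => /eqP.
move=> i ni; have [lt_im|] := ltnP i m.
  case: (eqVneq (f i) 0) => [->|/min_m]; first by rewrite mul0r.
  by rewrite leqNgt lt_im.
rewrite leq_eqVlt => /predU1P[e|lt_mi].
  by case/eqP: ni; apply: val_inj.
by rewrite IHn ?mulr0 //; have := ltn_ord i; lia.
Qed.

Lemma ps_mulfI f : f != 0 -> injective ( *%R f).
Proof.
move=> f0 g h e; apply/eqP; rewrite -subr_eq0; apply/eqP.
by apply: (ps_mulf_eq0 _ f0); rewrite mulrBr e subrr.
Qed.

Lemma ps_neq0 f n : f n != 0 -> f != 0.
Proof. by apply: contraNneq => ->. Qed.

Lemma qX_neq0 n : (qX n : ps K) != 0.
Proof. by apply: (@ps_neq0 _ n); rewrite /qX eqxx oner_neq0. Qed.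

End PowerSeriesDomain.

(** * Infinite sums and products *)

Section Infinite.
Variable K : comNzRingType.
Implicit Types (F G : nat -> ps K) (n : nat).

(** Coefficient n is read off the first n factors, and off the first n + 1 terms for [sinf]. These
    are the right values when factor i is 1 modulo q^(i+1) and term i is 0 modulo q^i, the standing
    conditions below. *)
Definition pinf F : ps K := fun n => (\prod_(i < n) F i) n.
Definition sinf F : ps K := fun n => (\sum_(i < n.+1) F i) n.

Lemma pinf_eqmod F n m : (forall i, eqmod i.+1 (F i) 1) -> (n <= m)%N ->
  eqmod n.+1 (pinf F) (\prod_(i < m) F i).
Proof.
move=> F1 le_nm i; rewrite ltnS => le_in; rewrite /pinf.
rewrite -!(big_mkord xpredT F) (@big_cat_nat _ _ _ i 0 m) //=; last first.
  exact: leq_trans le_nm.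
rewrite -{1}[\prod_(0 <= j < i) F j]mulr1.
apply: (@eqmodM _ i.+1) => //; apply: eqmod_sym; rewrite big_nat.
by apply: eqmod_prod1 => j /andP[le_ij _]; apply: eqmodW (F1 j).
Qed.

Lemma eq_pinf F G : F =1 G -> pinf F = pinf G.
Proof. by move=> /funext ->. Qed.

Lemma pinfM F G : (forall i, eqmod i.+1 (F i) 1) ->
  (forall i, eqmod i.+1 (G i) 1) ->
  pinf (fun i => F i * G i) = pinf F * pinf G.
Proof.
move=> F1 G1; apply: eqmod_eq => n; apply: (@eqmodW _ _ n.+1) => //.
have FG1 i : eqmod i.+1 (F i * G i) 1.
  by rewrite -[1]mulr1; apply: eqmodM.
apply: eqmod_trans (pinf_eqmod FG1 (leqnn n)) _; rewrite big_split /=.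
by apply: eqmod_sym; apply: eqmodM; apply: pinf_eqmod.
Qed.

Lemma pinf1 : pinf (fun=> 1) = 1.
Proof. by apply/funext => n; rewrite /pinf big1. Qed.

(** Serves to compare a product over one residue class modulo k with a product over all exponents:
    each block of k consecutive factors meets the class once. *)
Lemma pinf_blocks k F : (0 < k)%N -> (forall i, eqmod i.+1 (F i) 1) ->
  pinf (fun i => \prod_(r < k) F (k * i + r)%N) = pinf F.
Proof.
move=> k_gt0 F1; apply: eqmod_eq => n; apply: (@eqmodW _ _ n.+1) => //.
have B1 i : eqmod i.+1 (\prod_(r < k) F (k * i + r)%N) 1.
  apply: eqmod_prod1 => r _; apply: eqmodW (F1 _); rewrite ltnS.
  by apply: leq_trans (leq_addr _ _); apply: leq_pmull.
apply: eqmod_trans (pinf_eqmod B1 (leqnn n)) _; apply: eqmod_sym.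
have -> : \prod_(i < n) \prod_(r < k) F (k * i + r)%N = \prod_(i < k * n) F i.
  elim: n {B1} => [|n IHn]; first by rewrite muln0 !big_ord0.
  rewrite big_ord_recr IHn /= mulnS addnC -!(big_mkord xpredT F).
  rewrite [RHS](@big_cat_nat _ _ _ (k * n)) //= ?leq_addr //; congr (_ * _).
  rewrite -{2}[(k * n)%N]add0n big_addn addKn !big_mkord.
  by apply: eq_bigr => i _; rewrite addnC.
by apply: pinf_eqmod => //; apply: leq_pmull.
Qed.

Lemma psub_prod k (I : Type) (r : seq I) (P : pred I) (F : I -> ps K) :
  (0 < k)%N ->
  psub k (\prod_(i <- r | P i) F i) = \prod_(i <- r | P i) psub k (F i).
Proof.
move=> k0; elim/big_rec2: _ => [|i x y _ <-]; first exact: psub1.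
by rewrite psubM.
Qed.

Lemma eqmod_sub k n (f g : ps K) :
  (0 < k)%N -> eqmod n f g -> eqmod (k * n) (psub k f) (psub k g).
Proof.
move=> k0 fg i lt_i; rewrite /psub; case: ifP => // _; apply: fg.
by rewrite ltn_divLR // mulnC.
Qed.

Lemma psub_pinf k F : (0 < k)%N -> (forall i, eqmod i.+1 (F i) 1) ->
  psub k (pinf F) = pinf (fun i => psub k (F i)).
Proof.
move=> k0 F1; apply: eqmod_eq => n.
have F1k i : eqmod i.+1 (psub k (F i)) 1.
  apply: (@eqmodW _ _ (k * i.+1)); first exact: leq_pmull.
  by rewrite -(psub1 K k0); apply: eqmod_sub.
apply: (@eqmodW _ _ n.+1) => //.
apply: eqmod_trans (eqmod_sym (pinf_eqmod F1k (leqnn n))).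
rewrite -psub_prod //; apply: (@eqmodW _ _ (k * n.+1)); first exact: leq_pmull.
by apply: eqmod_sub => //; apply: pinf_eqmod.
Qed.

Lemma sinf_eqmod F n m : (forall i, eqmod i (F i) 0) -> (n <= m)%N ->
  eqmod n (sinf F) (\sum_(i < m) F i).
Proof.
move=> F0 le_nm i lt_in; rewrite /sinf.
rewrite -!(big_mkord xpredT F) [in RHS](@big_cat_nat _ _ _ i.+1 0 m) //=; last first.
  exact: leq_trans le_nm.
rewrite psD [X in _ + X](_ : _ = 0) ?addr0 //.
rewrite ps_sum big_nat big1 // => j /andP[lt_ij _].
by rewrite (F0 j).
Qed.

(* \prod_(i >= 1) (1 - c_i q^i), the factor of index i being [eulF c i.-1]. *)
Definition eulF (c : nat -> K) i : ps K := 1 - psC (c i.+1) * qX i.+1.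
Definition eul c : ps K := pinf (eulF c).

Lemma eulF1 c i : eqmod i.+1 (eulF c i) 1.
Proof.
rewrite -[1]subr0; apply: eqmodB => //; apply: eqmod0Mr.
exact: eqmod_qX.
Qed.

Lemma eul_const0 c : eul c 0%N = 1.
Proof. by rewrite /eul /pinf big_ord0. Qed.

Lemma eul_sub k c : (0 < k)%N ->
  psub k (eul c) = eul (fun i => if (k %| i)%N then c (i %/ k)%N else 0).
Proof.
case: k => // k _; rewrite /eul psub_pinf //; last exact: eulF1.
rewrite -[RHS](@pinf_blocks k.+1) //; last exact: eulF1.
(* Only the last exponent of a block is divisible by the modulus; the other factors are 1. *)
apply: eq_pinf => i; rewrite big_ord_recr big1 /= ?mul1r; last first.
  move=> r _; rewrite /eulF; case: ifPn => [|_]; last by rewrite psC0 mul0r subr0.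
  rewrite -addnS dvdn_addr ?dvdn_mulr // => /dvdn_leq.
  by rewrite ltnNge => /(_ isT); have := ltn_ord r; lia.
rewrite /eulF (_ : (k.+1 * i + k).+1 = (k.+1 * i.+1)%N); last by lia.
rewrite dvdn_mulr // mulKn //.
by rewrite psubB psub1 // psubM // psubC // psub_qX.
Qed.

End Infinite.

(** * The Jacobi triple product *)

Section FiniteTripleProduct.
Variables (R : comNzRingType) (p S : R) (L : nat) (t : nat -> R).
Hypothesis t0 : t 0%N = 1.
Hypothesis t1 : t 1%N = p + S.
Hypothesis tSS : forall n,
  t n.+2 = S * p ^+ n.+1 * t n.+1 - p ^+ (2 * n + 3) * t n.

(** Write (p)_k for the product of 1 - p^i over 1 <= i <= k. For k >= 1, [E k] plays the part of
    (p)_L / (p)_(k-1), so [a N n] is (p)_L^2 / (p)_(2N+1) times the Gaussian binomial of 2N+1 over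
    N-n, written without division. Since [E 0] is 0, [a N N.+1] vanishes as that binomial does. When
    S = p (z + 1/z), [t n] is p^(n(n+1)/2) times the sum of z^j over |j| <= n. *)
Let E k := \prod_(k <= i < L.+1) (1 - p ^+ i).
Let a N n := E (N.+1 - n) * E (N + n + 2).

Local Lemma E_rec k : (k <= L)%N -> E k = (1 - p ^+ k) * E k.+1.
Proof. by move=> le_kL; rewrite /E big_ltn. Qed.

Definition jtp_sum N := \sum_(n < N.+1) (-1) ^+ n * a N n * t n.

(** The recurrence in N does not hold term by term, because S t_n brings in the neighbours t_(n-1)
    and t_(n+1). Summed up to M, these contributions telescope to the two boundary terms on the
    right. *)
Local Lemma jtp_partial N M : (2 * N + 3 <= L)%N -> (M <= N)%N ->
  \sum_(n < M.+1) ((-1) ^+ n * ((1 - p ^+ (2 * N + 2)) * (1 - p ^+ (2 * N + 3))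
       * a N.+1 n - (1 + p ^+ (2 * N + 2) - S * p ^+ N) * a N n) * t n)
  = (-1) ^+ M * (p ^+ (N - M) * a N M * t M.+1
                 + p ^+ (N + M + 2) * a N M.+1 * t M).
Proof.
move=> leL; elim: M => [|M IHM] leMN.
  rewrite big_ord1 expr0 t0 t1 /a !subn0 !addn0 subSS subn0 !mul1r !mulr1.
  have -> : (N + 1 + 2 = N.+3)%N by lia.
  have -> : (N.+1 + 2 = N.+3)%N by lia.
  rewrite !addn2 (@E_rec N.+1) ?(@E_rec N.+2); [|lia|lia].
  rewrite (_ : E N = (1 - p ^+ N) * (1 - p ^+ N.+1) * E N.+2); last first.
    by rewrite E_rec ?(@E_rec N.+1) ?mulrA //; lia.
  have [-> ->] : (2 * N + 3 = N + N + 3 /\ (2 * N).+2 = N + N + 2)%N by lia.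
  rewrite (@E_rec N.+2) ?(@E_rec N.+3) //; try lia.
  rewrite !exprD !exprS; set P := p ^+ N; ring.
rewrite big_ord_recr /= IHM 1?ltnW // {IHM} tSS.
have [d eN] : exists d, N = (M + d).+1 by exists (N - M.+1)%N; lia.
rewrite /a.
have -> : (N - M = d.+1)%N by lia.
have -> : (N - M.+1 = d)%N by lia.
have -> : (N.+1 - M = d.+2)%N by lia.
have -> : (N.+1 - M.+1 = d.+1)%N by lia.
have -> : (N.+1 - M.+2 = d)%N by lia.
have -> : (N.+2 - M.+1 = d.+2)%N by lia.
have -> : (N + M + 2 = (M + M + d + 3))%N by lia.
have -> : (N + M.+1 + 2 = (M + M + d + 3).+1)%N by lia.
have -> : (N + M.+2 + 2 = (M + M + d + 3).+2)%N by lia.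
have -> : (N.+1 + M.+1 + 2 = (M + M + d + 3).+2)%N by lia.
set Z := (M + M + d + 3)%N.
rewrite (@E_rec d) ?(@E_rec d.+1) ?(@E_rec Z) ?(@E_rec Z.+1); try lia.
have -> : (2 * N + 2 = M + M + d + d + 4)%N by lia.
have -> : (2 * N + 3 = M + M + d + d + 5)%N by lia.
have -> : (2 * M + 3 = M + M + 3)%N by lia.
have -> : N = (M + d + 1)%N by lia.
rewrite /Z !exprS !exprD; set P := p ^+ M; set Q := p ^+ d; ring.
Qed.

Lemma jtp_step N : (2 * N + 3 <= L)%N ->
  (1 - p ^+ (2 * N + 2)) * (1 - p ^+ (2 * N + 3)) * jtp_sum N.+1
  = (1 - S * p ^+ N + p ^+ (2 * N + 2)) * jtp_sum N.
Proof.
move=> leL; apply/eqP; rewrite -subr_eq0; apply/eqP.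
rewrite /jtp_sum [in X in X - _]big_ord_recr /= mulrDr addrAC.
rewrite !mulr_sumr -sumrB.
pose b (i : nat) := (-1) ^+ i * ((1 - p ^+ (2 * N + 2)) * (1 - p ^+ (2 * N + 3))
  * a N.+1 i - (1 + p ^+ (2 * N + 2) - S * p ^+ N) * a N i) * t i.
rewrite (eq_bigr (fun i : 'I_N.+1 => b i)); last by move=> i _; rewrite /b; ring.
(* At M = N the second boundary term contains [E 0] and vanishes; the first cancels the top term n =
   N + 1 of [jtp_sum N.+1]. *)
rewrite jtp_partial // subnn expr0 mul1r /a subnn.
have -> : E 0 = 0 by rewrite E_rec // expr0 subrr mul0r.
have -> : (N.+2 - N.+1 = 1)%N by lia.
have -> : (N.+1 - N = 1)%N by lia.
have -> : (N.+1 + N.+1 + 2 = (2 * N + 2).+2)%N by lia.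
have -> : (N + N + 2 = 2 * N + 2)%N by lia.
rewrite (@E_rec (2 * N + 2)) ?(@E_rec (2 * N + 2).+1); try lia.
have -> : (2 * N + 3 = (2 * N + 2).+1)%N by lia.
rewrite !exprS; set P := p ^+ (2 * N + 2); set s := (-1) ^+ N; ring.
Qed.

Lemma jtp_finite N : (2 * N + 1 <= L)%N ->
  \prod_(1 <= i < (2 * N + 2)%N) (1 - p ^+ i) * jtp_sum N
  = \prod_(i < N) (1 - S * p ^+ i + p ^+ (2 * i + 2)) * (E 1 * E 1).
Proof.
elim: N => [|N IHN] leL.
  rewrite muln0 add0n big_nat1 big_ord0 /jtp_sum big_ord1 /a expr0 t0 !mul1r.
  by rewrite subn0 addn0 mulr1 {2}(@E_rec 1) //; ring.
rewrite big_ord_recr /= -mulrA [_ * (E 1 * E 1)]mulrC mulrA -IHN; last lia.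
have -> : (2 * N.+1 + 2 = (2 * N + 2).+2)%N by lia.
rewrite (@big_nat_recr _ _ _ (2 * N + 2).+1) /=; last lia.
rewrite big_nat_recr /=; last lia.
rewrite -[RHS]mulrA [jtp_sum N * _]mulrC -jtp_step; last lia.
have -> : (2 * N + 3 = (2 * N + 2).+1)%N by lia.
ring.
Qed.

End FiniteTripleProduct.

Section TripleProduct.
Variables (K : idomainType) (k : nat) (S : ps K) (t : nat -> ps K).
Hypothesis k_gt0 : (0 < k)%N.
Hypothesis S0 : S 0%N = 0.
Let p : ps K := qX k.
Hypothesis t0 : t 0%N = 1.
Hypothesis t1 : t 1%N = p + S.
Hypothesis tSS : forall n,
  t n.+2 = S * p ^+ n.+1 * t n.+1 - p ^+ (2 * n + 3) * t n.

Local Lemma p_eqmod m n : (m <= n)%N -> eqmod m (p ^+ n) 0.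
Proof.
move=> le_mn; rewrite /p qXn; apply: eqmod_qX.
by apply: leq_trans le_mn _; apply: leq_pmull.
Qed.

Local Lemma S_eqmod : eqmod 1 S 0. Proof. by case. Qed.

Lemma jtp_term_eqmod n : eqmod n (t n) 0.
Proof.
suff [] : eqmod n (t n) 0 /\ eqmod n.+1 (t n.+1) 0 by [].
elim: n => [|n [IH1 IH2]].
  split=> //; rewrite t1 -[0]addr0; apply: eqmodD; last exact: S_eqmod.
  exact: (@p_eqmod 1 1).
split=> //; rewrite tSS -[0]subr0; apply: eqmodB.
  by apply: (@eqmodW _ _ (n.+1 + n.+1)); [lia | rewrite -mulrA mulrC -mulrA;
    apply: eqmod0M; [exact: p_eqmod | exact: eqmod0Ml]].
apply: eqmod0Ml; apply: p_eqmod; lia.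
Qed.

(** With S = p (z + 1/z) this is Jacobi's triple product divided by 1 - z: the theta terms z^(-n)
    and z^(n+1) have opposite signs and the same power of p, and z^(-n) - z^(n+1) is 1 - z times the
    sum of z^j over |j| <= n. *)
Theorem triple_product :
  sinf (fun n => (-1) ^+ n * t n)
  = pinf (fun i => (1 - p ^+ i.+1) * (1 - S * p ^+ i + p ^+ (2 * i + 2))).
Proof.
(* For this L the product on the left of [jtp_finite] is [E 1], which cancels one of the two such
   factors on the right. *)
apply: eqmod_eq => N; set L := (2 * N + 1)%N.
pose E k : ps K := \prod_(k <= i < L.+1) (1 - p ^+ i).
have E1 m : eqmod m (E m) 1.
  rewrite /E big_nat; apply: eqmod_prod1 => i /andP[le_mi _].
  by rewrite -[1 in X in eqmod _ _ X]subr0; apply: eqmodB => //; apply: p_eqmod.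
have := @jtp_finite _ p S L t t0 t1 tSS N (leqnn _).
rewrite -/(E 1) (_ : \prod_(1 <= i < (2 * N + 2)%N) (1 - p ^+ i) = E 1%N); last first.
  by rewrite /E /L; congr bigop; congr index_iota; lia.
rewrite [RHS]mulrCA => /(ps_mulfI _) e.
have {e} e : jtp_sum p L t N
  = \prod_(i < N) (1 - S * p ^+ i + p ^+ (2 * i + 2)) * E 1%N.
  by apply: e; apply: (@ps_neq0 _ _ 0); rewrite (E1 1%N) // ps1 oner_neq0.
(* The weight of t_n may be replaced by 1 modulo q^N: [E (N.+1 - n)] is 1 modulo q^(N+1-n), while
   t_n is divisible by q^n. *)
have a1 : eqmod N (sinf (fun n => (-1) ^+ n * t n)) (jtp_sum p L t N).
  apply: (@eqmod_trans _ _ (\sum_(n < N.+1) (-1) ^+ n * t n)).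
    apply: (@sinf_eqmod _ (fun n => (-1) ^+ n * t n)) => // i.
    by apply: eqmod0Mr; apply: jtp_term_eqmod.
  rewrite /jtp_sum; apply: eqmod_sum => n _; rewrite -!mulrA.
  apply: eqmodM => //; rewrite mulrCA -/(E _) -/(E _).
  have h : eqmod N (E (N.+1 - n)%N * t n) (t n).
    rewrite -[X in eqmod _ _ X]add0r -{1}[E _](subrK 1) mulrDl mul1r.
    apply: eqmodD => //; apply: (@eqmodW _ _ (N.+1 - n + n)); first by lia.
    have E0 : eqmod (N.+1 - n) (E (N.+1 - n)%N - 1) 0.
      by rewrite -[X in eqmod _ _ X](subrr 1); apply: eqmodB.
    exact: (eqmod0M E0 (@jtp_term_eqmod n)).
  rewrite -[X in eqmod _ X _]mul1r; apply: eqmodM.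
    by apply: eqmod_sym; apply: eqmodW (E1 _); lia.
  exact: eqmod_sym.
apply: eqmod_trans a1 _; rewrite e.
have f1 i : eqmod i.+1 (1 - p ^+ i.+1) 1.
  by rewrite -[1 in X in eqmod _ _ X]subr0; apply: eqmodB => //; apply: p_eqmod.
have f2 i : eqmod i.+1 (1 - S * p ^+ i + p ^+ (2 * i + 2)) 1.
  rewrite -[1 in X in eqmod _ _ X]addr0; apply: eqmodD; last first.
    by apply: p_eqmod; lia.
  rewrite -[1 in X in eqmod _ _ X]subr0; apply: eqmodB => //.
  by apply: (@eqmod0M _ 1 i); [exact: S_eqmod | exact: p_eqmod].
rewrite pinfM // mulrC; apply: eqmodM.
  apply: eqmod_sym; apply: (@eqmodW _ _ N.+1) => //.
  rewrite /E big_add1 big_mkord /=.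
  by apply: (@pinf_eqmod _ (fun i => 1 - p ^+ i.+1)) => //; rewrite /L; lia.
by apply: eqmod_sym; apply: (@eqmodW _ _ N.+1) => //; apply: pinf_eqmod.
Qed.

End TripleProduct.

(** * Generating functions of weighted sets *)

Section GeneratingFunctions.
Local Open Scope classical_set_scope.
Variable K : idomainType.

Definition proper_map (T : Type) (e : T -> nat) :=
  forall m, finite_set (e @^-1` [set m]).

(* \sum_(x in D) w x q^(e x); meaningful when e has finite fibres. *)
Definition gf (T : choiceType) (D : set T) (e : T -> nat) (w : T -> K) : ps K :=
  fun m => \sum_(x \in D `&` e @^-1` [set m]) w x.

Lemma eq_gf (T : choiceType) (D : set T) (e e' : T -> nat) (w w' : T -> K) :
  (forall x, D x -> e x = e' x) -> (forall x, D x -> w x = w' x) ->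
  gf D e w = gf D e' w'.
Proof.
move=> ee' ww'; apply/funext => m; rewrite /gf.
have -> : D `&` e @^-1` [set m] = D `&` e' @^-1` [set m].
  by apply/seteqP; split=> x /= [Dx]; rewrite -?ee' // ee'.
by apply: eq_fsbigr => x; rewrite inE => -[Dx _]; apply: ww'.
Qed.

Lemma gf_reindex (T U : choiceType) (h : U -> T) (D' : set U) (D : set T)
    (e : T -> nat) (w : T -> K) :
  (forall u, D' u -> D (h u)) ->
  (forall u v, D' u -> D' v -> h u = h v -> u = v) ->
  (forall x, D x -> exists2 u, D' u & h u = x) ->
  gf D e w = gf D' (e \o h) (w \o h).
Proof.
move=> hD h_inj h_surj; apply/funext => m; apply: reindex_fsbig; split.
- by move=> u /= [D'u eu]; split=> //; apply: hD.
- by move=> u v; rewrite !inE => -[D'u _] [D'v _]; apply: h_inj.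
move=> x /= [Dx ex]; have [u D'u hu] := h_surj x Dx.
by exists u => //; split=> //=; rewrite hu.
Qed.

Lemma gf_split (T : choiceType) (P D : set T) (e : T -> nat) (w : T -> K) :
  proper_map e ->
  gf D e w = gf (D `&` P) e w + gf (D `&` ~` P) e w.
Proof.
move=> pe; apply/funext => m; rewrite psD /gf (fsbigID P); last first.
  exact/finite_setIr/pe.
by rewrite ![_ `&` e @^-1` _ `&` _]setIAC.
Qed.

Lemma gf_add (T : choiceType) (D : set T) (e : T -> nat) (w w' : T -> K) :
  proper_map e -> gf D e (fun x => w x + w' x) = gf D e w + gf D e w'.
Proof.
move=> pe; apply/funext => m; rewrite psD /gf.
by rewrite !fsbig_finite ?big_split //; apply/finite_setIr/pe.
Qed.

Lemma gf_scale (T : choiceType) (D : set T) (e : T -> nat) (c : K) (w : T -> K) :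
  gf D e (fun x => c * w x) = psC c * gf D e w.
Proof.
by apply/funext => m; rewrite psCM_coef /gf mulr_fsumr.
Qed.

Lemma gf_sub k (T : choiceType) (D : set T) (e : T -> nat) (w : T -> K) :
  (0 < k)%N -> psub k (gf D e w) = gf D (fun x => k * e x)%N w.
Proof.
move=> k0; apply/funext => m; rewrite /psub /gf.
case: ifPn => [/dvdnP[j ->]|ndiv]; last first.
  rewrite (_ : _ `&` _ = set0) ?fsbig_set0 //.
  by apply/seteqP; split=> x //= [_ em]; case/negP: ndiv; rewrite -em dvdn_mulr.
rewrite mulnK //; apply: eq_fsbigl; apply/seteqP.
split=> x /= [Dx]; first by move=> ->; rewrite mulnC.
by rewrite mulnC => /eqP; rewrite eqn_pmul2r // => /eqP.
Qed.

Lemma gf_shift k (T : choiceType) (D : set T) (e : T -> nat) (w : T -> K) :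
  qX k * gf D e w = gf D (fun x => e x + k)%N w.
Proof.
apply/funext => m; rewrite qXM /gf; case: leqP => [le_km|lt_mk].
  by apply: eq_fsbigl; apply/seteqP; split=> x /= [Dx] ?; split=> //; lia.
rewrite (_ : _ `&` _ = set0) ?fsbig_set0 //.
by apply/seteqP; split=> x //= [_]; lia.
Qed.

Lemma pder_gf (T : choiceType) (D : set T) (e : T -> nat) (w : T -> K) :
  pder (gf D e w) = gf D e (fun x => (e x)%:R * w x).
Proof.
apply/funext => m; rewrite /pder /gf -mulr_natl mulr_fsumr.
by apply: eq_fsbigr => x; rewrite inE => -[_ /= ->].
Qed.

Lemma proper_pair (T U : choiceType) (e : T -> nat) (e' : U -> nat) :
  proper_map e -> proper_map e' ->
  proper_map (fun z : T * U => e z.1 + e' z.2)%N.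
Proof.
move=> pe pe' m.
have le_fin (V : choiceType) (f : V -> nat) : proper_map f ->
    finite_set [set x | (f x <= m)%N].
  move=> pf; apply: (@sub_finite_set _ _ (\bigcup_(i in `I_m.+1) f @^-1` [set i])).
    by move=> x /= le_x; exists (f x) => //=; rewrite ltnS.
  by apply: bigcup_finite => [|i _]; [apply: finite_II | apply: pf].
apply: (@sub_finite_set _ _ ([set x | (e x <= m)%N] `*` [set x | (e' x <= m)%N])).
  by move=> [x y] /= <-; split=> /=; lia.
by apply: finite_setX; apply: le_fin.
Qed.

Lemma gf_mul (T U : choiceType) (D : set T) (D' : set U) (e : T -> nat)
    (e' : U -> nat) (w : T -> K) (w' : U -> K) :
  proper_map e -> proper_map e' ->
  gf D e w * gf D' e' w' =
  gf (D `*` D') (fun z => e z.1 + e' z.2)%N (fun z => w z.1 * w' z.2).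
Proof.
move=> pe pe'; apply/funext => m; rewrite psM /gf.
set Z := (X in _ = \sum_(x \in X) _).
have finZ : finite_set Z by apply/finite_setIr/proper_pair.
rewrite [RHS]fsbig_finite //.
transitivity (\sum_(i < m.+1) \sum_(z <- fset_set Z | e z.1 == i) w z.1 * w' z.2).
  apply: eq_bigr => i _.
  set A := D `&` _; set B := D' `&` _.
  have fA : finite_set A by apply/finite_setIr/pe.
  have fB : finite_set B by apply/finite_setIr/pe'.
  transitivity (\sum_(z \in A `*` B) w z.1 * w' z.2).
    rewrite -(pair_fsbig _ (fun x y => w x * w' y)) // mulr_fsuml.
    by apply: eq_fsbigr => x _; rewrite mulr_fsumr.
  rewrite (fsbig_fwiden [seq z <- fset_set Z | e z.1 == i]) ?big_filter //.
  - move=> [x y] /= [[Dx ex] [Dy ey]]; rewrite mem_filter /= ex eqxx /=.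
    rewrite in_fset_set //; apply/mem_set; split=> //=; rewrite ex ey subnKC //.
    exact: leq_ord.
  - by rewrite filter_uniq.
  move=> [x y] /= []; rewrite mem_filter /= in_fset_set //.
  move=> /andP[/eqP ex /set_mem[[/= Dx Dy] exy]] []; split; split => //.
  by apply: (canRL (addKn i)); rewrite -ex.
rewrite (exchange_big_dep xpredT) //= [LHS]big_seq_cond [RHS]big_seq_cond.
apply: eq_bigr => z; rewrite andbT in_fset_set // => /set_mem[_ /= ez].
have lt_z : (e z.1 < m.+1)%N by rewrite ltnS -ez leq_addr.
by rewrite (big_pred1 (Ordinal lt_z)).
Qed.

Lemma sinf_gf (e : nat -> nat) (w : nat -> K) : (forall n, (n <= e n)%N) ->
  sinf (fun n => psC (w n) * qX (e n)) = gf setT e w.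
Proof.
move=> le_e; apply/funext => m; rewrite /sinf ps_sum /gf setTI.
set r := [seq i <- iota 0 m.+1 | e i == m].
have rP i : (i \in r) = (e i == m).
  rewrite mem_filter mem_iota /= add0n ltnS andb_idr // => /eqP <-.
  exact: le_e.
rewrite (fsbig_fwiden r); first last.
- by move=> i []; rewrite /= rP => /eqP ei [].
- by rewrite filter_uniq // iota_uniq.
- by move=> i /= ei; rewrite rP ei.
rewrite big_filter -(big_mkord xpredT (fun i => (psC (w i) * qX (e i)) m)).
rewrite /index_iota subn0 [RHS]big_mkcond /=; apply: eq_bigr => i _.
by rewrite psCM_coef /qX eq_sym; case: eqP => _; rewrite ?mulr1 ?mulr0.
Qed.

Lemma proper_leq (T : choiceType) (e e' : T -> nat) :
  proper_map e -> (forall x, (e x <= e' x)%N) -> proper_map e'.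
Proof.
move=> pe le_e m.
apply: (@sub_finite_set _ _ (\bigcup_(i in `I_m.+1) e @^-1` [set i])).
  by move=> x /= <-; exists (e x) => //=; rewrite ltnS.
by apply: bigcup_finite => [|i _]; [apply: finite_II | apply: pe].
Qed.

Lemma proper_id : proper_map (@id nat).
Proof. by move=> m; apply: (@sub_finite_set _ _ [set m]). Qed.

Lemma proper_absz : proper_map absz.
Proof.
move=> m; apply: (@sub_finite_set _ _ [set (m%:Z)%R; (- m%:Z)%R]) => //.
by move=> x /= <-; case: (intP x) => [|n|n]; [left|left|right].
Qed.

End GeneratingFunctions.

(** * Theta series *)

Section Theta.
Local Open Scope classical_set_scope.
Variable K : fieldType.

Lemma eul_shift (x p : ps K) : x 0%N = 0 -> p 0%N = 0 ->
  (1 - x) * pinf (fun i => 1 - x * p ^+ i.+1) = pinf (fun i => 1 - x * p ^+ i).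
Proof.
move=> x0 p0.
have pn n : eqmod n (p ^+ n) 0.
  elim: n => [|n IHn]; first by [].
  by rewrite exprS; apply: (@eqmod0M _ 1) => // -[].
have xp n : eqmod n.+1 (x * p ^+ n) 0 by apply: (@eqmod0M _ 1) => // -[].
have h n : eqmod n.+1 (1 - x * p ^+ n) 1.
  by rewrite -[1 in X in eqmod _ _ X]subr0; apply: eqmodB.
have h' n : eqmod n.+1 (1 - x * p ^+ n.+1) 1 by apply: eqmodW (h n.+1).
apply: eqmod_eq => n; apply: (@eqmodW _ _ n.+1) => //.
apply: eqmod_trans (eqmod_sym (pinf_eqmod h (leqnSn n))).
rewrite big_ord_recl /= expr0 mulr1; apply: eqmodM => //.
exact: (pinf_eqmod h' (leqnn n)).
Qed.

(** Makes [eul (resc k a c)] the product of 1 - c q^i over i = a modulo k. With the class stored in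
    the coefficients, identities between products over different classes reduce to one factor at a
    time. *)
Definition resc (k a : nat) (c : K) (i : nat) : K := if (i == a %[mod k])%N then c else 0.

Lemma eul_resc k a c : (0 < a <= k)%N ->
  pinf (fun i => 1 - psC c * qX (k * i + a)) = eul (resc k a c).
Proof.
case: a => // a /andP[_ lt_ak].
rewrite /eul -[RHS](@pinf_blocks _ k); [|lia|exact: eulF1].
apply: eq_pinf => i; rewrite (bigD1 (Ordinal lt_ak)) //= big1 ?mulr1.
  by rewrite /eulF /resc -!addnS mulnC modnMDl eqxx.
move=> r ra; rewrite /eulF /resc -addnS mulnC modnMDl -(addn1 r) -(addn1 a) eqn_modDr.
rewrite !modn_small // ifN ?psC0 ?mul0r ?subr0 //.
Qed.
End Theta.

Section ThetaProducts.
Local Open Scope classical_set_scope.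
Variable K : fieldType.

Fixpoint jt (p S : ps K) n : ps K :=
  match n with
  | 0 => 1
  | 1 => p + S
  | (m.+1 as m').+1 => S * p ^+ m' * jt p S m' - p ^+ (2 * m + 3) * jt p S m
  end.

Lemma jtSS p S n :
  jt p S n.+2 = S * p ^+ n.+1 * jt p S n.+1 - p ^+ (2 * n + 3) * jt p S n.
Proof. by []. Qed.

Lemma jt_triple k (S : ps K) : (0 < k)%N -> S 0%N = 0 ->
  sinf (fun n => (-1) ^+ n * jt (qX k) S n)
  = pinf (fun i => (1 - qX k ^+ i.+1) * (1 - S * qX k ^+ i + qX k ^+ (2 * i + 2))).
Proof. by move=> k0 S0; apply: triple_product. Qed.

Lemma sinf_eqmod_le (F : nat -> ps K) n : (forall i, eqmod i (F i) 0) ->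
  eqmod n (sinf F) (\sum_(i < n) F i).
Proof. by move=> F0; apply: sinf_eqmod. Qed.

Lemma sinfMl (g : ps K) (F : nat -> ps K) : (forall i, eqmod i (F i) 0) ->
  g * sinf F = sinf (fun i => g * F i).
Proof.
move=> F0; apply: eqmod_eq => n.
have gF0 i : eqmod i (g * F i) 0 by apply: eqmod0Mr.
apply: eqmod_trans (eqmod_sym (sinf_eqmod_le gF0)).
by rewrite -mulr_sumr; apply: eqmodM => //; apply: sinf_eqmod_le.
Qed.

Lemma sinfD (F G : nat -> ps K) :
  sinf (fun i => F i + G i) = sinf F + sinf G.
Proof. by apply/funext => n; rewrite psD /sinf big_split. Qed.

Lemma eq_sinf (F G : nat -> ps K) : F =1 G -> sinf F = sinf G.
Proof. by move=> /funext ->. Qed.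

Lemma jt_eqmod (k : nat) (S : ps K) n : (0 < k)%N -> S 0%N = 0 ->
  eqmod n (jt (qX k) S n) 0.
Proof.
move=> k0 S0.
exact: (@jtp_term_eqmod K k S (jt (qX k) S) k0 S0 erefl (fun=> erefl)).
Qed.

(* k j (j - 1) / 2 + b j when k = a + b, written without subtraction. *)
Definition thE (k a b : nat) (j : int) : nat :=
  match j with
  | Posz n => k * 'C(n, 2) + b * n
  | Negz n => k * 'C(n.+1, 2) + a * n.+1
  end%N.

Lemma thEP k a b j : k = (a + b)%N ->
  (2 * (thE k a b j)%:Z = k%:Z * j * (j - 1) + 2 * b%:Z * j)%R.
Proof.
move=> ->; case: j => n /=.
  have e := bin2_sum n; have h : ('C(n, 2).*2 = n * n.-1)%N.
    by rewrite bin2 -[RHS]odd_double_half oddM; case: n {e} => //= n; rewrite andNb.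
  case: n h {e} => [|n] h; first by rewrite !muln0 addn0 !mulr0.
  by rewrite -muln2 /= in h; nia.
have h : ('C(n.+1, 2).*2 = n.+1 * n)%N.
  by rewrite bin2 -[RHS]odd_double_half oddM /= andNb.
by rewrite -muln2 in h; rewrite NegzE; nia.
Qed.

Section FType.
Variables (k a b : nat) (eps : K).
Hypotheses (a_gt0 : (0 < a)%N) (b_gt0 : (0 < b)%N) (kE : k = (a + b)%N).
Hypothesis eps2 : eps * eps = 1.
Let x : ps K := psC eps * qX a.
Let y : ps K := psC eps * qX b.
Let p : ps K := qX k.

Local Lemma pE : p = x * y.
Proof. by rewrite /p /x /y mulrACA -psCM eps2 mul1r kE qXD. Qed.

Local Lemma x0 : x 0%N = 0.
Proof. by rewrite /x psM0 /qX eq_sym eqn0Ngt a_gt0 mulr0. Qed.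
Local Lemma y0 : y 0%N = 0.
Proof. by rewrite /y psM0 /qX eq_sym eqn0Ngt b_gt0 mulr0. Qed.
Local Lemma p0 : p 0%N = 0.
Proof. by rewrite pE psM0 x0 mul0r. Qed.

(** Here z = x: since p = x y, the series x p + y is p (x + 1/x). Multiplying back by 1 - x leaves
    the two theta terms of index n and -n - 1. *)
Local Lemma jt_telescope n :
  (1 - x) * jt p (x * p + y) n
  = p ^+ 'C(n, 2) * y ^+ n - p ^+ 'C(n.+1, 2) * x ^+ n.+1.
Proof.
pose u n := p ^+ 'C(n, 2) * y ^+ n - p ^+ 'C(n.+1, 2) * x ^+ n.+1.
suff [] : (1 - x) * jt p (x * p + y) n = u n /\
          (1 - x) * jt p (x * p + y) n.+1 = u n.+1 by [].
elim: n => [|n [IH1 IH2]].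
  have [e02 e12 e22] : [/\ 'C(0, 2) = 0, 'C(1, 2) = 0 & 'C(2, 2) = 1]%N by [].
  by split; rewrite /u /= ?e02 ?e12 ?e22 ?expr1 ?expr0 ?pE; ring.
split=> //; rewrite jtSS.
rewrite mulrBr mulrCA IH2 (mulrCA _ (p ^+ _)) IH1 /u.
have -> : 'C(n.+3, 2) = ('C(n, 2) + n + n + n + 3)%N by rewrite !binS ?bin0 !bin1; lia.
have -> : 'C(n.+2, 2) = ('C(n, 2) + n + n + 1)%N by rewrite !binS ?bin0 !bin1; lia.
have -> : 'C(n.+1, 2) = ('C(n, 2) + n)%N by rewrite !binS ?bin0 !bin1; lia.
have -> : (2 * n + 3 = n + n + 3)%N by lia.
rewrite !exprD !exprS; set P := p ^+ 'C(_, _); set Q := p ^+ n.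
rewrite !expr0 !mulr1 pE; ring.
Qed.

Local Lemma pn_eqmod n : eqmod n (p ^+ n) 0.
Proof.
elim: n => [|n IHn]; first by [].
by rewrite exprS; apply: (@eqmod0M _ 1) => // -[] // _; apply: p0.
Qed.

Local Lemma factor_eqmod (z : ps K) n :
  z 0%N = 0 -> eqmod n.+1 (1 - z * p ^+ n) 1.
Proof.
move=> z0; rewrite -[1 in X in eqmod _ _ X]subr0; apply: eqmodB => //.
by apply: (@eqmod0M _ 1); [case | apply: pn_eqmod].
Qed.

Lemma proper_thE : proper_map (thE k a b).
Proof.
apply: proper_leq proper_absz _ => -[n|n] /=; nia.
Qed.

Theorem theta_product : gf setT (thE k a b) (fun j => (- eps) ^+ `|j|%N)
  = eul (resc k k 1) * eul (resc k a eps) * eul (resc k b eps).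
Proof.
have k_gt0 : (0 < k)%N by rewrite kE addn_gt0 a_gt0.
set S := x * p + y.
have S0 : S 0%N = 0 by rewrite /S psD psM0 x0 y0 mul0r addr0.
transitivity ((1 - x) * sinf (fun n => (-1) ^+ n * jt p S n)).
  rewrite sinfMl; last by move=> i; apply: eqmod0Mr; apply: jt_eqmod.
  rewrite (@eq_sinf _ (fun n =>
      psC ((- eps) ^+ n) * qX (k * 'C(n, 2) + b * n)
      + psC ((- eps) ^+ n.+1) * qX (k * 'C(n.+1, 2) + a * n.+1))); last first.
    move=> n; rewrite mulrCA jt_telescope /x /y.
    have psCX (c : K) m : psC (c ^+ m) = psC c ^+ m.
      by elim: m => [|m IHm] //; rewrite !exprS psCM IHm.
    rewrite !qXD -!qXn -/p !psCX psCN !exprMn !exprS [(- psC eps) ^+ n]exprNn.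
    ring.
  rewrite sinfD (@sinf_gf _ (fun n => k * 'C(n, 2) + b * n)%N (fun n => (- eps) ^+ n)); last by nia.
  rewrite (@sinf_gf _ (fun n => k * 'C(n.+1, 2) + a * n.+1)%N (fun n => (- eps) ^+ n.+1)); last by nia.
  rewrite (gf_split (range Posz)); last exact: proper_thE.
  congr (_ + _).
    apply: (@gf_reindex _ _ _ Posz) => [u _|u v _ _ []|z [_ [n _ <-]]] //.
    by exists n.
  apply: (@gf_reindex _ _ _ Negz) => [u _|u v _ _ []|[n|n] [_ nn]] //.
  - by split=> // -[].
  - by case: nn; exists n.
  by exists n.
rewrite jt_triple //.
rewrite (@eq_pinf _ _ (fun i => (1 - p * p ^+ i) * ((1 - x * p ^+ i.+1) * (1 - y * p ^+ i)))); last first.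
  move=> i; have -> : (2 * i + 2 = i.+1 + i.+1)%N by lia.
  rewrite -exprS exprD /S !exprS -/p; set P := p ^+ i; rewrite !pE; ring.
have h1 i : eqmod i.+1 (1 - p * p ^+ i) 1 by apply: factor_eqmod; apply: p0.
have h2 i : eqmod i.+1 (1 - x * p ^+ i.+1) 1.
  by apply: (@eqmodW _ _ i.+2) => //; apply: factor_eqmod; apply: x0.
have h3 i : eqmod i.+1 (1 - y * p ^+ i) 1 by apply: factor_eqmod; apply: y0.
rewrite pinfM //; last by move=> i; rewrite -[1 in X in eqmod _ _ X]mulr1; apply: eqmodM.
(* The spare factor 1 - x completes the product of the 1 - x p^(i+1) to the full residue class of
   a. *)
rewrite pinfM // mulrCA [(1 - x) * _]mulrA eul_shift ?x0 ?p0 //.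
rewrite mulrA -!eul_resc ?k_gt0 ?leqnn ?a_gt0 ?b_gt0 ?kE ?leq_addr ?leq_addl //.
by congr (_ * _ * _); apply: eq_pinf => i; rewrite /x /y /p ?psC1 ?mul1r -?mulrA qXn -qXD kE addnC.
Qed.

End FType.

(* \sum_(|j| <= n) z^j *)
Fixpoint zsum (z : K) n : K :=
  if n is m.+1 then zsum z m + z ^+ n + z ^- n else 1.

Lemma jt_zsum (z : K) n : z != 0 ->
  jt (qX 1) (psC (z + z^-1) * qX 1) n = psC (zsum z n) * qX 'C(n.+1, 2).
Proof.
move=> z0.
suff [] : jt (qX 1) (psC (z + z^-1) * qX 1) n = psC (zsum z n) * qX 'C(n.+1, 2) /\
  jt (qX 1) (psC (z + z^-1) * qX 1) n.+1 = psC (zsum z n.+1) * qX 'C(n.+2, 2) by [].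
elim: n => [|n [IH1 IH2]].
  split; rewrite /= ?mul1r //.
  by rewrite -addrA [in RHS]psCD [in RHS]mulrDl psC1 mul1r expr1.
split=> //; rewrite jtSS IH1 IH2.
rewrite !qXn !mul1n.
rewrite -(mulrA (psC (z + _))) -qXD mulrACA -psCM -qXD mulrCA -qXD.
have -> : 'C(n.+3, 2) = ('C(n, 2) + n + n + n + 3)%N by rewrite !binS ?bin0 !bin1; lia.
have -> : 'C(n.+2, 2) = ('C(n, 2) + n + n + 1)%N by rewrite !binS ?bin0 !bin1; lia.
have -> : 'C(n.+1, 2) = ('C(n, 2) + n)%N by rewrite !binS ?bin0 !bin1; lia.
have -> : (1 + n.+1 + ('C(n, 2) + n + n + 1) = 'C(n, 2) + n + n + n + 3)%N by lia.
have -> : (2 * n + 3 + ('C(n, 2) + n) = 'C(n, 2) + n + n + n + 3)%N by lia.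
rewrite -mulrBl -psCN -psCD; congr (psC _ * _).
have e m : z ^- m.+1 * z = z ^- m by rewrite exprS invfM mulrAC mulVf ?mul1r.
have key m : (z + z^-1) * zsum z m.+1 = zsum z m.+2 + zsum z m.
  elim: m => [|m IHm]; first by rewrite /=; field.
  rewrite [zsum z m.+2]/= -/(zsum z m.+1) -addrA mulrDr IHm.
  rewrite [zsum z m.+3]/= -/(zsum z m.+2) [zsum z m.+1 in RHS]/= -/(zsum z m).
  rewrite !exprS !invfM; field; by rewrite expf_neq0 ?z0.
by rewrite key addrK.
Qed.

Definition tri n : nat := 'C(n.+1, 2).

(** The triple product with constant z, to be used at z = -1 for psi, at z = 1 for f_1^3 and at
    fifth roots of unity. *)
Theorem theta_zsum (z : K) : z != 0 ->
  gf setT tri (fun n => (-1) ^+ n * zsum z n)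
  = eul (fun=> 1) * eul (fun=> z) * eul (fun=> z^-1).
Proof.
move=> z0; set S := psC (z + z^-1) * qX 1.
have S0 : S 0%N = 0 by rewrite /S psM0 /qX mulr0.
transitivity (sinf (fun n => (-1) ^+ n * jt (qX 1) S n)).
  rewrite -sinf_gf; last first.
    by move=> n; rewrite /tri binS bin1; lia.
  apply: eq_sinf => n; rewrite jt_zsum // mulrA; congr (_ * _).
  have -> : psC ((-1) ^+ n * zsum z n) = psC ((-1) ^+ n) * psC (zsum z n) by rewrite psCM.
  congr (_ * _); elim: n => [|n IHn]; first by [].
  by rewrite !exprS psCM IHn psCN.
rewrite jt_triple // /eul -!pinfM; try exact: eulF1; last first.
  by move=> i; rewrite -[1 in X in eqmod _ _ X]mulr1; apply: eqmodM; apply: eulF1.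
apply: eq_pinf => i; rewrite /eulF /S !qXn !mul1n psC1 mul1r -[RHS]mulrA.
congr (_ * _); have -> : (2 * i + 2 = i.+1 + i.+1)%N by lia.
rewrite qXD -mulrA -qXD add1n; set X := qX _.
have e : psC z * psC z^-1 = 1 by rewrite -psCM divff.
transitivity (1 - (psC z + psC z^-1) * X + psC z * psC z^-1 * X * X); last by ring.
by rewrite e psCD; ring.
Qed.

End ThetaProducts.

(** * Sums over Gaussian integers divisible by 2 + i *)

Section Lattice.
Local Open Scope classical_set_scope.
Variable K : fieldType.
Variable L : set int.
Hypothesis L_mul : forall x y, L x -> L y -> L (- (x + 2 * y)) /\ L (2 * x - y).
Hypothesis L_div : forall x y, L (- (x + 2 * y)) -> L (2 * x - y) -> L x /\ L y.
Hypothesis L5 : forall x, L (5 * x) <-> L x.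

Definition nsq (x : int) : nat := (`|x| * `|x|)%N.
Definition gnorm (z : int * int) : nat := (nsq z.1 + nsq z.2)%N.

Lemma nsqE x : (nsq x)%:Z = x * x. Proof. by rewrite /nsq; lia. Qed.

Lemma proper_nsq : proper_map nsq.
Proof. by apply: proper_leq proper_absz _ => x; rewrite /nsq; nia. Qed.

Lemma proper_gnorm : proper_map gnorm.
Proof. by apply: proper_pair; apply: proper_nsq. Qed.

Definition pm1 : set int := [set u | L u /\ ((u %% 5)%Z = 1 \/ (u %% 5)%Z = 4)].
Definition pm2 : set int := [set u | L u /\ ((u %% 5)%Z = 2 \/ (u %% 5)%Z = 3)].

(** Multiplication by -1 + 2i = i (2 + i), the associate of 2 + i that preserves the condition that
    both coordinates are 1 modulo 4. *)
Definition gmul (z : int * int) : int * int := (- (z.1 + 2 * z.2), 2 * z.1 - z.2).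

Lemma gnorm_gmul z : gnorm (gmul z) = (5 * gnorm z)%N.
Proof. by case: z => x y; have := nsqE; rewrite /gnorm /gmul /= /nsq; nia. Qed.

(** The image of [gmul] consists of the (u, v) with 5 dividing 2u + v. Either 5 divides both
    coordinates, or one is 1 or -1 and the other 2 or -2 modulo 5. For (u, v) in [pm1] times [pm2]
    exactly one of (u, v) and (v, u) lies in the image, whence the test in the last weight. *)
Theorem gauss_split (W : int * int -> K) :
  psub 5 (gf (L `*` L) gnorm (W \o gmul))
  = psub 25 (gf (L `*` L) gnorm (fun z => W (5 * z.1, 5 * z.2)))
    + gf (pm1 `*` pm2) gnorm
        (fun z => if ((2 * z.1 + z.2) %% 5)%Z == 0 then W z else W (z.2, z.1)).
Proof.
pose D := (L `*` L) `&` [set z | ((2 * z.1 + z.2) %% 5)%Z = 0].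
have -> : psub 5 (gf (L `*` L) gnorm (W \o gmul)) = gf D gnorm W.
  rewrite gf_sub // (@gf_reindex _ _ _ gmul (L `*` L) D).
  - by apply: eq_gf => z _ //=; rewrite gnorm_gmul.
  - move=> [x y] [/= Lx Ly]; have [L1 L2] := L_mul Lx Ly; split=> //=; lia.
  - by move=> [x y] [x' y'] _ _ [] ? ?; congr (_, _); lia.
  move=> [u v] [[/= Lu Lv] /= uv].
  have [x [y [ex ey]]] : exists x y, u = - (x + 2 * y) /\ v = 2 * x - y.
    (* This is (u + iv) / (-1 + 2i) = (u + iv)(-1 - 2i) / 5. *)
    by exists ((2 * v - u) %/ 5)%Z, (- ((2 * u + v) %/ 5)%Z); lia.
  exists (x, y); last by rewrite /gmul /= ex ey.
  by split=> /=; have [] := @L_div x y; rewrite -?ex -?ey.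
rewrite (gf_split [set z | (z.1 %% 5)%Z = 0]); last exact: proper_gnorm.
congr (_ + _).
  rewrite gf_sub // (@gf_reindex _ _ _ (fun z : int * int => (5 * z.1, 5 * z.2))
    (L `*` L) (D `&` [set z | (z.1 %% 5)%Z = 0])).
  - by apply: eq_gf => z _ //=; rewrite /gnorm /nsq !abszM /=; nia.
  - by move=> [x y] [/= Lx Ly]; do ?split => /=; rewrite ?L5 //; lia.
  - by move=> [x y] [x' y'] _ _ [] ? ?; congr (_, _); lia.
  move=> [u v] [[[/= Lu Lv] /= uv] u0].
  have [ex ey] : u = 5 * (u %/ 5)%Z /\ v = 5 * (v %/ 5)%Z by lia.
  exists ((u %/ 5)%Z, (v %/ 5)%Z); last by rewrite /= -ex -ey.
  by split=> /=; apply/L5; rewrite -?ex -?ey.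
set P := [set z : int * int | ((2 * z.1 + z.2) %% 5)%Z = 0].
rewrite (gf_split [set z | (z.1 %% 5)%Z = 1 \/ (z.1 %% 5)%Z = 4]); last exact: proper_gnorm.
rewrite [RHS](gf_split P); last exact: proper_gnorm.
congr (_ + _).
  have -> : D `&` ~` [set z | (z.1 %% 5)%Z = 0]
      `&` [set z | (z.1 %% 5)%Z = 1 \/ (z.1 %% 5)%Z = 4] = (pm1 `*` pm2) `&` P.
    apply/seteqP; split=> -[u v] /=.
      by move=> [[[[/= Lu Lv] /= uv] _] u1]; do ?split => //=; lia.
    move=> [[[Lu /= u1] [Lv /= v1]] /= uv]; do ?split => //=; lia.
  by apply: eq_gf => // z [_ ->].
rewrite (@gf_reindex _ _ _ (fun z : int * int => (z.2, z.1)) ((pm1 `*` pm2) `&` ~` P)).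
- apply: eq_gf => -[u v] /=; first by rewrite /gnorm /= addnC.
  by move=> [_ /= /eqP/negbTE ->].
- move=> [u v] [[[/= Lu u1] [/= Lv v1]]]; rewrite /P /= => uv; do ?split => //=; lia.
- by move=> [x y] [x' y'] _ _ [] -> ->.
move=> [u v] [[[[/= Lu Lv] /= uv] /= u0] /= u1]; exists (v, u) => //.
by do ?split => //=; rewrite /P /=; lia.
Qed.

End Lattice.

(** * Product formulas *)

Section ThetaIdentities.
Local Open Scope classical_set_scope.
Variable K : fieldType.

Lemma prod_eul (r : seq (nat -> K)) :
  \prod_(c <- r) eul c = pinf (fun i => \prod_(c <- r) eulF c i).
Proof.
have F1 (cs : seq (nat -> K)) i : eqmod i.+1 (\prod_(c <- cs) eulF c i) 1.
  by apply: eqmod_prod1 => c _; apply: eulF1.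
elim: r => [|c r IHr].
  by rewrite big_nil -[LHS]pinf1; apply: eq_pinf => i; rewrite big_nil.
rewrite big_cons IHr -pinfM //; last exact: eulF1.
by apply: eq_pinf => i; rewrite big_cons.
Qed.

Lemma eul_prodE (cs ds : seq (nat -> K)) :
  (forall i, \prod_(c <- cs) eulF c i = \prod_(d <- ds) eulF d i) ->
  \prod_(c <- cs) eul c = \prod_(d <- ds) eul d.
Proof. by move=> e; rewrite !prod_eul; apply: eq_pinf. Qed.

(* In terms of the f_k of the paper: f1 = f_1, g1 = f_2 / f_1, r0 = f_2,
   r1 = f_1 / f_2, and below f5 = f_5, g5 = f_10 / f_5. *)
Definition f1 : ps K := eul (fun=> 1).
Definition g1 : ps K := eul (fun=> -1).
Definition r0 : ps K := eul (resc 2 2 1).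
Definition r1 : ps K := eul (resc 2 1 1).

Lemma eul_neq0 (c : nat -> K) : eul c != 0.
Proof. by apply: (@ps_neq0 _ _ 0); rewrite eul_const0 oner_neq0. Qed.
Lemma psub_neq0 k (f : ps K) : (0 < k)%N -> f != 0 -> psub k f != 0.
Proof.
move=> k0; apply: contraNneq => e; apply/eqP/(psub_inj k0); rewrite e.
by apply/funext => n; rewrite /psub ps0 if_same.
Qed.

Lemma r0_sub : psub 2 f1 = r0.
Proof.
rewrite /f1 eul_sub // /r0; congr eul.
Qed.

Lemma r0E : r0 = f1 * g1.
Proof.
rewrite -r0_sub /f1 /g1 /eul -pinfM; try exact: eulF1.
rewrite psub_pinf //; last exact: eulF1.
apply: eq_pinf => i; rewrite /eulF psubB psub1 // psubM // psubC // psub_qX //.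
rewrite mul2n -addnn qXD psCN psC1; ring.
Qed.

Lemma f1_r : f1 = r0 * r1.
Proof.
have := @eul_prodE [:: fun=> 1] [:: resc 2 2 1; resc 2 1 1].
rewrite !big_cons !big_nil !mulr1; apply=> i.
rewrite !big_cons !big_nil !mulr1 /eulF /resc.
have [->|->] : (i.+1 %% 2 = 0 \/ i.+1 %% 2 = 1)%N by lia.
  by rewrite /= psC1 psC0; ring.
by rewrite /= psC1 psC0; ring.
Qed.

Lemma r1_g1 : r1 * g1 = 1.
Proof.
apply: (ps_mulfI (eul_neq0 (resc 2 2 1))); rewrite -/r0 mulr1 mulrA -f1_r.
by rewrite r0E.
Qed.

Definition f5 : ps K := psub 5 f1.
Definition g5 : ps K := psub 5 g1.

(** In Ramanujan's notation these are psi(q), Jacobi's series for f_1^3, phi(-q), f(-q^2,-q^3),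
    f(-q,-q^4), f(q^2,q^3), f(q,q^4), f(-q^3,-q^7) and f(-q,-q^9). *)
Definition psi : ps K := gf setT tri (fun=> 1).
Definition cub : ps K := gf setT tri (fun n => (-1) ^+ n * (2 * n + 1)%:R).
Definition phi : ps K := gf setT nsq (fun x => (-1) ^+ `|x|%N).
Definition thA : ps K := gf setT (thE 5 2 3) (fun j => (-1) ^+ `|j|%N).
Definition thB : ps K := gf setT (thE 5 1 4) (fun j => (-1) ^+ `|j|%N).
Definition thP : ps K := gf setT (thE 5 2 3) (fun=> 1).
Definition thQ : ps K := gf setT (thE 5 1 4) (fun=> 1).
Definition th7 : ps K := gf setT (thE 10 3 7) (fun j => (-1) ^+ `|j|%N).
Definition th9 : ps K := gf setT (thE 10 1 9) (fun j => (-1) ^+ `|j|%N).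

Lemma psiE : psi = f1 * g1 * g1.
Proof.
rewrite /psi /f1 /g1; have n0 : (-1 : K) != 0 by rewrite oppr_eq0 oner_neq0.
have := theta_zsum n0; rewrite invrN1 => <-; apply: eq_gf => // n _.
have -> : zsum (-1) n = (-1) ^+ n :> K.
  by elim: n => [|n IHn] //=; rewrite IHn invr_sign exprS mulN1r subrr add0r.
by rewrite -expr2 sqrr_sign.
Qed.

Lemma cubE : cub = f1 ^+ 3.
Proof.
rewrite /cub /f1; have := theta_zsum (oner_neq0 K).
rewrite invr1 => e; rewrite !exprS expr0 mulr1 mulrA -e; apply: eq_gf => // n _.
congr (_ * _); elim: n => [|n IHn] //=; rewrite -IHn expr1n invr1.
by rewrite -[1]/(1%:R) -!natrD; congr _%:R; lia.
Qed.

Lemma phiE : phi * g1 = f1.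
Proof.
have -> : phi = r0 * r1 * r1.
  rewrite /r0 /r1 -theta_product ?mul1r //; apply: eq_gf => // x _.
  have := @thEP 2 1 1 x erefl; have := nsqE x; lia.
by rewrite -mulrA r1_g1 mulr1 -f1_r.
Qed.

Lemma thAE : thA = eul (resc 5 5 1) * eul (resc 5 2 1) * eul (resc 5 3 1).
Proof. by rewrite -theta_product ?mul1r. Qed.
Lemma thBE : thB = eul (resc 5 5 1) * eul (resc 5 1 1) * eul (resc 5 4 1).
Proof. by rewrite -theta_product ?mul1r. Qed.
Lemma thPE : thP = eul (resc 5 5 1) * eul (resc 5 2 (-1)) * eul (resc 5 3 (-1)).
Proof.
rewrite -theta_product ?mulrNN ?mul1r //; apply: eq_gf => // j _.
by rewrite opprK expr1n.
Qed.
Lemma thQE : thQ = eul (resc 5 5 1) * eul (resc 5 1 (-1)) * eul (resc 5 4 (-1)).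
Proof.
rewrite -theta_product ?mulrNN ?mul1r //; apply: eq_gf => // j _.
by rewrite opprK expr1n.
Qed.
Lemma th7E : th7 = eul (resc 10 10 1) * eul (resc 10 3 1) * eul (resc 10 7 1).
Proof. by rewrite -theta_product ?mul1r. Qed.
Lemma th9E : th9 = eul (resc 10 10 1) * eul (resc 10 1 1) * eul (resc 10 9 1).
Proof. by rewrite -theta_product ?mul1r. Qed.

Lemma f5E : f5 = eul (resc 5 5 1).
Proof.
by rewrite /f5 eul_sub //; congr eul; apply/funext => i; rewrite /resc modnn.
Qed.
Lemma g5E : g5 = eul (resc 5 5 (-1)).
Proof.
by rewrite /g5 eul_sub //; congr eul; apply/funext => i; rewrite /resc modnn.
Qed.

Lemma thAB : thA * thB = f1 * f5.
Proof.
rewrite thAE thBE f5E.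
have := @eul_prodE [:: resc 5 5 1; resc 5 2 1; resc 5 3 1; resc 5 5 1;
  resc 5 1 1; resc 5 4 1] [:: fun=> 1; resc 5 5 1].
rewrite !big_cons !big_nil !mulr1 !mulrA => -> // i.
rewrite !big_cons !big_nil !mulr1 /eulF /resc.
have := ltn_pmod i.+1 (isT : 0 < 5)%N.
by move: (i.+1 %% 5)%N => [|[|[|[|[|]]]]] // _; rewrite /= ?psCN ?psC1 ?psC0; ring.
Qed.

Lemma thPQ : thP * thQ * g5 = g1 * f5 * f5.
Proof.
rewrite thPE thQE f5E g5E.
have := @eul_prodE [:: resc 5 5 1; resc 5 2 (-1); resc 5 3 (-1); resc 5 5 1;
  resc 5 1 (-1); resc 5 4 (-1); resc 5 5 (-1)] [:: fun=> -1; resc 5 5 1; resc 5 5 1].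
rewrite !big_cons !big_nil !mulr1 !mulrA => -> // i.
rewrite !big_cons !big_nil !mulr1 /eulF /resc.
have := ltn_pmod i.+1 (isT : 0 < 5)%N.
by move: (i.+1 %% 5)%N => [|[|[|[|[|]]]]] // _; rewrite /= ?psCN ?psC1 ?psC0; ring.
Qed.

(** The residues 1, 3, 7, 9 modulo 10 are the odd ones other than 5, so the two theta products
    contain [r1] with its multiples of 5 removed; [g1] is the inverse of [r1]. *)
Lemma th79 : th7 * th9 * g1 = f5 ^+ 2 * g5 ^+ 3.
Proof.
have e5 : psub 5 r1 * g5 = 1 by rewrite -psubM // r1_g1 psub1.
have r05 : psub 5 r0 = f5 * g5 by rewrite r0E psubM.
have r0e : psub 5 r0 = eul (resc 10 10 1).
  rewrite /r0 eul_sub //; congr eul; apply/funext => i; rewrite /resc !modnn.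
  have -> : (i %% 10 == 0)%N = (5 %| i)%N && ((i %/ 5) %% 2 == 0)%N by lia.
  by case: (5 %| i)%N.
have r1e : psub 5 r1 = eul (resc 10 5 1).
  rewrite /r1 eul_sub //; congr eul; apply/funext => i; rewrite /resc.
  have -> : (i %% 10 == 5 %% 10)%N = (5 %| i)%N && ((i %/ 5) %% 2 == 1 %% 2)%N by lia.
  by case: (5 %| i)%N.
have h : th7 * th9 * psub 5 r1 = r1 * (psub 5 r0 * psub 5 r0).
  rewrite th7E th9E r1e r0e.
  have := @eul_prodE [:: resc 10 10 1; resc 10 3 1; resc 10 7 1; resc 10 10 1;
    resc 10 1 1; resc 10 9 1; resc 10 5 1] [:: resc 2 1 1; resc 10 10 1; resc 10 10 1].
  rewrite !big_cons !big_nil !mulr1 !mulrA => -> // i.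
  rewrite !big_cons !big_nil !mulr1 /eulF /resc.
  have -> : (i.+1 %% 2 = (i.+1 %% 10) %% 2)%N by lia.
  have := ltn_pmod i.+1 (isT : 0 < 10)%N.
  by move: (i.+1 %% 10)%N => [|[|[|[|[|[|[|[|[|[|]]]]]]]]]] // _;
    rewrite /= ?psCN ?psC1 ?psC0; ring.
transitivity (th7 * th9 * g1 * (psub 5 r1 * g5)); first by rewrite e5 mulr1.
transitivity (th7 * th9 * psub 5 r1 * (g1 * g5)); first by ring.
rewrite h r05; transitivity (r1 * g1 * (f5 ^+ 2 * g5 ^+ 3)); first by ring.
by rewrite r1_g1 mul1r.
Qed.

End ThetaIdentities.

(** * Quadratic theta identities *)

Section QuadraticIdentities.
Local Open Scope classical_set_scope.
Variable K : fieldType.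

Definition L4 : set int := [set x | (x %% 4)%Z = 1].

Lemma L4_mul x y : L4 x -> L4 y -> L4 (- (x + 2 * y)) /\ L4 (2 * x - y).
Proof. by rewrite /L4 /=; lia. Qed.
Lemma L4_div x y : L4 (- (x + 2 * y)) -> L4 (2 * x - y) -> L4 x /\ L4 y.
Proof. by rewrite /L4 /=; lia. Qed.
Lemma L4_5 x : L4 (5 * x) <-> L4 x.
Proof. by rewrite /L4 /=; lia. Qed.

(* Enumerates the integers congruent to 1 modulo 4 by increasing absolute value. *)
Definition oddnum (n : nat) : int :=
  if odd n then - (2 * n + 1)%N%:Z else (2 * n + 1)%N%:Z.

(** From (2n+1)^2 = 8 n(n+1)/2 + 1, each odd square being attained once on [L4]. *)
Lemma gf_L4 (w : int -> K) :
  gf L4 nsq w = qX 1 * psub 8 (gf setT tri (fun n => w (oddnum n))).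
Proof.
rewrite gf_sub // gf_shift (@gf_reindex _ _ _ oddnum setT).
- apply: eq_gf => // n _ /=; rewrite /oddnum /tri.
  have := @thEP 1 1 0 n.+1 erefl; rewrite /= => h.
  by case: ifP => _; rewrite /nsq; nia.
- by move=> n _; rewrite /L4 /oddnum /=; case: ifPn; lia.
- by move=> m n _ _; rewrite /oddnum; do 2 case: ifPn; lia.
move=> x; rewrite /L4 /= => x1; exists (`|x| %/ 2)%N => //.
by rewrite /oddnum; case: ifPn; lia.
Qed.

(** The elements of [pm1 L4] and [pm2 L4] are, up to sign, the 10j + 1 and the 10j + 3; on both sets
    this is the sign (-1)^j of the series A and B. *)
Definition sgn5 (u : int) : K :=
  if ((u %% 5)%Z == 1) || ((u %% 5)%Z == 2) then 1 else -1.

Lemma signr_absz (j : int) : (-1) ^+ `|j|%N = (if (j %% 2)%Z == 0 then 1 else -1) :> K.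
Proof.
rewrite -signr_odd; case: ifP => h; first by have -> : odd `|j| = false by lia.
by have -> : odd `|j| = true by lia.
Qed.

Lemma gf_pm1 (w : int -> K) : gf (pm1 L4) nsq w =
  qX 1 * psub 40 (gf setT (thE 5 2 3)
    (fun j => w (if (j %% 2)%Z == 0 then 10 * j + 1 else - (10 * j + 1)))).
Proof.
pose h j : int := if (j %% 2)%Z == 0 then 10 * j + 1 else - (10 * j + 1).
rewrite gf_sub // gf_shift (@gf_reindex _ _ _ h setT).
- apply: eq_gf => // j _ /=; have := @thEP 5 2 3 j erefl; have := nsqE (h j).
  by rewrite /h; case: ifP => _; nia.
- by move=> n _; rewrite /pm1 /L4 /h /=; case: ifPn; lia.
- by move=> m n _ _; rewrite /h; do 2 case: ifPn; lia.
move=> x; rewrite /pm1 /L4 /= => -[x1 [] x5].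
  by exists ((x - 1) %/ 10)%Z => //; rewrite /h; case: ifPn; lia.
by exists (- (x + 1) %/ 10)%Z => //; rewrite /h; case: ifPn; lia.
Qed.

Lemma gf_pm2 (w : int -> K) : gf (pm2 L4) nsq w =
  qX 9 * psub 40 (gf setT (thE 5 1 4)
    (fun j => w (if (j %% 2)%Z == 0 then - (10 * j + 3) else 10 * j + 3))).
Proof.
pose h j : int := if (j %% 2)%Z == 0 then - (10 * j + 3) else 10 * j + 3.
rewrite gf_sub // gf_shift (@gf_reindex _ _ _ h setT).
- apply: eq_gf => // j _ /=; have := @thEP 5 1 4 j erefl; have := nsqE (h j).
  by rewrite /h; case: ifP => _; nia.
- by move=> n _; rewrite /pm2 /L4 /h /=; case: ifPn; lia.
- by move=> m n _ _; rewrite /h; do 2 case: ifPn; lia.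
move=> x; rewrite /pm2 /L4 /= => -[x1 [] x5].
  by exists (- (x + 3) %/ 10)%Z => //; rewrite /h; case: ifPn; lia.
by exists ((x - 3) %/ 10)%Z => //; rewrite /h; case: ifPn; lia.
Qed.

Lemma gf_psi : gf L4 nsq (fun=> 1) = qX 1 * psub 8 (psi K).
Proof. exact: gf_L4. Qed.

Lemma gf_cub : gf L4 nsq (fun x => x%:~R) = qX 1 * psub 8 (cub K).
Proof.
rewrite gf_L4; congr (_ * psub _ _); apply: eq_gf => // n _.
rewrite /oddnum -signr_odd; case: odd; rewrite ?expr1 ?expr0 ?mul1r //.
by rewrite mulN1r mulrNz.
Qed.

Lemma gf_thA : gf (pm1 L4) nsq sgn5 = qX 1 * psub 40 (thA K).
Proof.
rewrite gf_pm1; congr (_ * psub _ _); apply: eq_gf => // j _.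
rewrite signr_absz /sgn5; case: ((j %% 2)%Z =P 0) => h.
  by rewrite ifT //; lia.
by rewrite ifF //; lia.
Qed.

Lemma gf_thB : gf (pm2 L4) nsq sgn5 = qX 9 * psub 40 (thB K).
Proof.
rewrite gf_pm2; congr (_ * psub _ _); apply: eq_gf => // j _.
rewrite signr_absz /sgn5; case: ((j %% 2)%Z =P 0) => h.
  by rewrite ifT //; lia.
by rewrite ifF //; lia.
Qed.

Lemma gf_thP : gf (pm1 L4) nsq (fun=> 1) = qX 1 * psub 40 (thP K).
Proof. by rewrite gf_pm1. Qed.

Lemma gf_thQ : gf (pm2 L4) nsq (fun=> 1) = qX 9 * psub 40 (thQ K).
Proof. by rewrite gf_pm2. Qed.

Lemma gf_mul_nsq (D D' : set int) (w w' : int -> K) :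
  gf D nsq w * gf D' nsq w' = gf (D `*` D') gnorm (fun z => w z.1 * w' z.2).
Proof. by apply: gf_mul; apply: proper_nsq. Qed.

(** [gauss_split] with weight 1 on [L4]. Odd squares are 1 modulo 8, so the identity first appears
    at q^40 with an extra factor q^10, and both are then removed. *)
Lemma psi_quadratic :
  psi K ^+ 2 = qX 1 * psub 5 (psi K) ^+ 2 + thP K * thQ K.
Proof.
have := gauss_split L4_mul L4_div L4_5 (fun=> 1 : K).
have -> : gf (L4 `*` L4) gnorm ((fun=> 1 : K) \o gmul) = (qX 1 * psub 8 (psi K)) ^+ 2.
  by rewrite -gf_psi expr2 gf_mul_nsq; apply: eq_gf => // z _; rewrite mulr1.
have -> : gf (pm1 L4 `*` pm2 L4) gnorm
    (fun z => if ((2 * z.1 + z.2) %% 5)%Z == 0 then 1 else 1 : K)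
    = (qX 1 * psub 40 (thP K)) * (qX 9 * psub 40 (thQ K)).
  rewrite -gf_thP -gf_thQ gf_mul_nsq; apply: eq_gf => // z _.
  by rewrite if_same mulr1.
rewrite !psubX // !psubM // !psub_psub // !psub_qX // => e.
apply: (@psub_inj _ 40) => //; apply: (ps_mulfI (qX_neq0 K 10)).
have X10 : (qX 10 : ps K) = qX 1 * qX 9 by rewrite -qXD.
have X10' : (qX 10 : ps K) = qX 5 ^+ 2 by rewrite qXn.
have X50 : (qX 25 : ps K) ^+ 2 = qX 10 * qX 40 by rewrite qXn -qXD.
rewrite psubD psubX // psubM // psubX // psubM // psub_psub // psub_qX //.
transitivity ((qX (5 * 1) * psub (5 * 8) (psi K)) ^+ 2).
  by rewrite [RHS]exprMn muln1 -X10'.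
rewrite e exprMn muln1 X50 mulrDr [in RHS]mulrA X10; congr (_ + _); ring.
Qed.

Lemma gf_swap (L : set int) (w : int * int -> K) :
  gf (L `*` L) gnorm w = gf (L `*` L) gnorm (fun z => w (z.2, z.1)).
Proof.
rewrite (@gf_reindex _ _ _ (fun z : int * int => (z.2, z.1)) (L `*` L)).
- by apply: eq_gf => // z _; rewrite /gnorm /= addnC.
- by move=> [x y] [].
- by move=> [x y] [x' y'] _ _ [] -> ->.
by move=> [x y] [Lx Ly]; exists (y, x).
Qed.

(* The weights x^2 - y^2 are antisymmetric, so only the term 8 x y of
   (x + 2 y)^2 - (2 x - y)^2 survives. *)
Lemma wronskian_AB (K_char0 : [pchar K] =i pred0) :
  thA K * thB K + 5%:R * (thA K * pder (thB K) - thB K * pder (thA K))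
  = cub K ^+ 2.
Proof.
pose d (z : int * int) : K := (z.1 * z.1 - z.2 * z.2)%:~R.
have d0 : gf (L4 `*` L4) gnorm d = 0.
  have e : gf (L4 `*` L4) gnorm d = - gf (L4 `*` L4) gnorm d.
    rewrite {1}gf_swap -[RHS]mulN1r -psC1 -psCN -gf_scale; apply: eq_gf => // z _.
    by rewrite /d /= mulN1r -mulrNz opprB.
  apply/funext => n; have /eqP := congr1 (fun f : ps K => f n) e.
  rewrite psN -subr_eq0 opprK -mulr2n -mulr_natl mulf_eq0.
  by rewrite ((pcharf0P K).1 K_char0) => /eqP.
have := gauss_split L4_mul L4_div L4_5 d.
have -> : gf (L4 `*` L4) gnorm (d \o gmul) = psC 8%:R * (qX 1 * psub 8 (cub K)) ^+ 2.
  rewrite -gf_cub expr2 gf_mul_nsq -gf_scale.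
  rewrite -[RHS]addr0 -[0 in RHS](mulr0 (psC (- 3%:R))) -d0 -gf_scale -gf_add; last exact: proper_gnorm.
  by apply: eq_gf => // -[x y] _; rewrite /d /gmul /=; ring.
have -> : gf (L4 `*` L4) gnorm (fun z => d (5 * z.1, 5 * z.2)) = 0.
  rewrite -[RHS](mulr0 (psC 25%:R)) -d0 -gf_scale; apply: eq_gf => // z _.
  by rewrite /d /=; ring.
set G := gf _ _ _ => e.
have {}e : psub 5 (psC 8%:R * (qX 1 * psub 8 (cub K)) ^+ 2) = G.
  rewrite e [X in X + _](_ : _ = 0) ?add0r //.
  by apply/funext => n; rewrite /psub ps0 if_same.
(* The product [sgn5 u * sgn5 v] is -1 when 5 divides 2u + v and 1 otherwise, so it turns v^2 - u^2
   into the weight of G, swap included; the squares are produced by [pder]. *)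
have : G = gf (pm1 L4) nsq sgn5 * pder (gf (pm2 L4) nsq sgn5)
           - pder (gf (pm1 L4) nsq sgn5) * gf (pm2 L4) nsq sgn5.
  rewrite !pder_gf !gf_mul_nsq -[- gf _ _ _]mulN1r -psC1 -psCN -gf_scale -gf_add; last exact: proper_gnorm.
  apply: eq_gf => // -[u v] [[_ u5] [_ v5]]; rewrite /d /sgn5 /=.
  have en (x : int) : (nsq x)%:R = (x * x)%:~R :> K by rewrite -nsqE.
  rewrite !en /= in u5 v5 *.
  by case: u5 v5 => u5 [] v5; [rewrite ifF|rewrite ifT|rewrite ifT|rewrite ifF];
    rewrite ?u5 ?v5 /=; try lia; ring.
rewrite -{}e gf_thA gf_thB !pderM !pder_qX !pder_sub // => e.
apply: (@psub_inj _ 40) => //; apply: (ps_mulfI (qX_neq0 K 10)).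
have n8 : psC (8%:R : K) != 0.
  apply: (@ps_neq0 _ _ 0); rewrite /psC mulr1n.
  by rewrite ((pcharf0P K).1 K_char0).
apply: (ps_mulfI n8).
have X10 : (qX 10 : ps K) = qX 1 * qX 9 by rewrite -qXD.
have X10' : (qX 10 : ps K) = qX 5 ^+ 2 by rewrite qXn.
have ps5 : psub 40 (5%:R : ps K) = 5%:R by rewrite -psC_nat psubC.
rewrite psubD psubX // psubM // psubM // ps5 psubB !psubM //.
transitivity (psub 5 (psC 8%:R * (qX 1 * psub 8 (cub K)) ^+ 2)); last first.
  rewrite psubM // psubC // psubX // psubM // psub_psub // psub_qX //.
  by rewrite exprMn muln1 X10'.
rewrite e X10 psC_nat; ring.
Qed.

(** The same splitting on all integers, with weight (-1)^(x+y), which [gmul] and multiplication by 5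
    preserve. The symmetry u -> -u doubles the sums over [pm1] and over [pm2], which gives the
    factor 4. *)
Lemma phi_quadratic (K_char0 : [pchar K] =i pred0) :
  phi K ^+ 2 = psub 5 (phi K) ^+ 2 - 4%:R * (qX 1 * (th7 K * th9 K)).
Proof.
pose s (x : int) : K := (-1) ^+ `|x|%N.
have LT_mul x y : [set: int] x -> [set: int] y ->
  [set: int] (- (x + 2 * y)) /\ [set: int] (2 * x - y) by [].
have LT_div x y : [set: int] (- (x + 2 * y)) -> [set: int] (2 * x - y) ->
  [set: int] x /\ [set: int] y by [].
have LT5 x : [set: int] (5 * x) <-> [set: int] x by [].
have sE x y : (x %% 2)%Z = (y %% 2)%Z -> s x = s y by rewrite /s !signr_absz => ->.
have h1 : gf (pm1 setT) nsq s = - (qX 1 * psub 5 (th7 K)) *+ 2.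
  have e : gf [set u : int | (u %% 5)%Z = 1] nsq s = - (qX 1 * psub 5 (th7 K)).
    rewrite -mulN1r -psC1 -psCN gf_sub // gf_shift -gf_scale.
    rewrite (@gf_reindex _ _ _ (fun j : int => 5 * j + 1) setT).
    - apply: eq_gf => j _ /=.
        by have := @thEP 10 3 7 j erefl; have := nsqE (5 * j + 1); lia.
      by rewrite /s !signr_absz; do 2 case: ifPn; rewrite ?mulN1r ?opprK //; lia.
    - by move=> j _ /=; lia.
    - by move=> i j _ _; lia.
    by move=> x /= x1; exists ((x - 1) %/ 5)%Z => //; lia.
  rewrite (gf_split [set u : int | (u %% 5)%Z = 1]); last exact: proper_nsq.
  rewrite mulr2n -e; congr (_ + _).
    by congr gf; apply/seteqP; split=> u /=; rewrite /pm1 /=; lia.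
  rewrite (@gf_reindex _ _ _ -%R [set u : int | (u %% 5)%Z = 1]).
  - by apply: eq_gf => u _ /=; [rewrite /nsq abszN | rewrite /s abszN].
  - by move=> u /=; rewrite /pm1 /=; lia.
  - by move=> u v _ _ /oppr_inj.
  by move=> u /=; rewrite /pm1 /= => hu; exists (- u); rewrite ?opprK //=; lia.
have h2 : gf (pm2 setT) nsq s = (qX 4 * psub 5 (th9 K)) *+ 2.
  have e : gf [set u : int | (u %% 5)%Z = 2] nsq s = qX 4 * psub 5 (th9 K).
    rewrite gf_sub // gf_shift.
    rewrite (@gf_reindex _ _ _ (fun j : int => 5 * j + 2) setT).
    - apply: eq_gf => j _ /=.
        by have := @thEP 10 1 9 j erefl; have := nsqE (5 * j + 2); lia.
      by rewrite /s !signr_absz; do 2 case: ifPn => //; lia.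
    - by move=> j _ /=; lia.
    - by move=> i j _ _; lia.
    by move=> x /= x1; exists ((x - 2) %/ 5)%Z => //; lia.
  rewrite (gf_split [set u : int | (u %% 5)%Z = 2]); last exact: proper_nsq.
  rewrite mulr2n -e; congr (_ + _).
    by congr gf; apply/seteqP; split=> u /=; rewrite /pm2 /=; lia.
  rewrite (@gf_reindex _ _ _ -%R [set u : int | (u %% 5)%Z = 2]).
  - by apply: eq_gf => u _ /=; [rewrite /nsq abszN | rewrite /s abszN].
  - by move=> u /=; rewrite /pm2 /=; lia.
  - by move=> u v _ _ /oppr_inj.
  by move=> u /=; rewrite /pm2 /= => hu; exists (- u); rewrite ?opprK //=; lia.
have := gauss_split LT_mul LT_div LT5 (fun z => s z.1 * s z.2).
have -> : gf ([set: int] `*` [set: int]) gnorm ((fun z => s z.1 * s z.2) \o gmul) = phi K ^+ 2.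
  rewrite expr2 gf_mul_nsq; apply: eq_gf => // -[x y] _ /=.
  by congr (_ * _); apply: sE; lia.
have -> : gf ([set: int] `*` [set: int]) gnorm
    (fun z => s (5 * z.1, 5 * z.2).1 * s (5 * z.1, 5 * z.2).2) = phi K ^+ 2.
  rewrite expr2 gf_mul_nsq; apply: eq_gf => // -[x y] _ /=.
  by congr (_ * _); apply: sE; lia.
have -> : gf (pm1 [set: int] `*` pm2 [set: int]) gnorm
    (fun z => if ((2 * z.1 + z.2) %% 5)%Z == 0 then s z.1 * s z.2
              else s (z.2, z.1).1 * s (z.2, z.1).2)
    = (- (qX 1 * psub 5 (th7 K)) *+ 2) * ((qX 4 * psub 5 (th9 K)) *+ 2).
  rewrite -h1 -h2 gf_mul_nsq; apply: eq_gf => // z _ /=.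
  by rewrite [s z.2 * _]mulrC if_same.
rewrite !psubX // => e; apply: (@psub_inj _ 5) => //.
have ps4 : psub 5 (4%:R : ps K) = 4%:R by rewrite -psC_nat psubC.
rewrite psubX // [LHS]e psubB psubX // psub_psub // !psubM // ps4 psub_qX //.
by rewrite -[(5 * 1)%N]/(1 + 4)%N qXD; ring.
Qed.

End QuadraticIdentities.

(** * Lambert series *)

Section LogarithmicDerivative.
Variable K : fieldType.

(** The expansion of - q d/dq log (1 - c_j q^j) for j = i + 1. *)
Definition lambF (c : nat -> K) i : ps K :=
  fun m => if (i.+1 %| m)%N && (0 < m)%N then i.+1%:R * c i.+1 ^+ (m %/ i.+1) else 0.

Definition lamb c : ps K := sinf (lambF c).

Lemma pder_eulF c i : pder (eulF c i) = - (eulF c i * lambF c i).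
Proof.
rewrite /eulF mulrBl mul1r pderD pderN pder_CM pder_qX -psC1 pder_C add0r.
rewrite -mulrA; congr (- _); apply/funext => m.
rewrite psB !psCM_coef psMn qXM /qX /lambF.
have [->|m0] := eqVneq m 0%N; first by rewrite ltnn andbF !mul0rn !mulr0 subr0.
rewrite lt0n m0 andbT; have [lt_mi|] := ltnP m i.+1.
  rewrite ltn_eqF // mul0rn !mulr0 subr0 ifN //.
  by apply/negP => /dvdn_leq; rewrite lt0n m0 leqNgt lt_mi => /(_ isT).
rewrite leq_eqVlt => /predU1P[<-|lt_im].
  by rewrite eqxx subnn ltnn andbF dvdnn divnn /= mulr0 subr0 expr1 mulrC.
rewrite gtn_eqF // mul0rn mulr0 subn_gt0 lt_im andbT.
rewrite dvdn_subl ?dvdnn ?(ltnW lt_im) //.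
case: ifPn => [/dvdnP[d ed]|_]; last by rewrite mulr0 subr0.
rewrite ed mulnK // (_ : (d * i.+1 - i.+1)%N = (d.-1 * i.+1)%N); last first.
  by rewrite -subn1 mulnBl mul1n.
rewrite mulnK // mulrCA -exprS.
by rewrite prednK ?subrr // lt0n; apply: contra_neq m0 => d0; rewrite ed d0.
Qed.

Lemma lambF_eqmod c i : eqmod i (lambF c i) 0.
Proof.
move=> m lt_mi; rewrite /lambF ifN //; apply/negP => /andP[/dvdn_leq h m0].
by have := h m0; rewrite leqNgt ltnS ltnW.
Qed.

Lemma pder_eul c : pder (eul c) = - (eul c * lamb c).
Proof.
apply: eqmod_eq => n.
have e : eqmod n (eul c) (\prod_(i < n) eulF c i).
  by apply: (@eqmodW _ _ n.+1) => //; apply: pinf_eqmod => //; apply: eulF1.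
apply: eqmod_trans (eqmod_pder e) _; apply: eqmod_sym.
apply: (@eqmod_trans _ _ (- (\prod_(i < n) eulF c i * \sum_(i < n) lambF c i))).
  apply: eqmodN; apply: eqmodM => //.
  by apply: sinf_eqmod => // i; apply: lambF_eqmod.
rewrite (_ : pder _ = - (\prod_(i < n) eulF c i * \sum_(i < n) lambF c i)) //.
elim: n {e} => [|n IHn]; first by rewrite !big_ord0 -psC1 pder_C mulr0 oppr0.
by rewrite !big_ord_recr /= pderM IHn pder_eulF; ring.
Qed.

Lemma lambE c m : (0 < m)%N ->
  lamb c m = \sum_(d < m.+1 | (d %| m)%N) d%:R * c d ^+ (m %/ d).
Proof.
move=> m0; rewrite /lamb /sinf ps_sum big_ord_recr /= [RHS]big_mkcond [RHS]big_ord_recl /=.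
rewrite mul0r if_same add0r [X in _ + X](_ : _ = 0) ?addr0; last first.
  by rewrite /lambF ifN //; apply/negP => /andP[/(dvdn_leq m0)]; rewrite ltnn.
by apply: eq_bigr => i _; rewrite /lambF m0 andbT.
Qed.

Lemma lamb0 c : lamb c 0%N = 0.
Proof. by rewrite /lamb /sinf big_ord_recl big_ord0 addr0 /lambF ltnn andbF. Qed.

End LogarithmicDerivative.

Definition chi5 (n : nat) : int :=
  match (n %% 5)%N with 1 | 4 => 1 | 2 | 3 => -1 | _ => 0 end.

Definition csum (m : nat) : int := \sum_(d < m.+1 | (d %| m)%N) chi5 (m %/ d) * d%:Z.
Definition esum5 (m : nat) : int := \sum_(d < m.+1 | (d %| m)%N) chi5 d * d%:Z.

Section Eisenstein.
Local Open Scope classical_set_scope.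
Variable K : fieldType.
Hypothesis K_char0 : [pchar K] =i pred0.

Definition Eser : ps K := fun m => if (0 < m)%N then (esum5 m)%:~R else 0.
Definition Cser : ps K := fun m => if (0 < m)%N then (csum m)%:~R else 0.

Lemma lamb_resc5 : lamb (resc 5 1 1) + lamb (resc 5 4 1) - lamb (resc 5 2 1)
  - lamb (resc 5 3 1) = Eser.
Proof.
apply/funext => m; rewrite !psB psD /Eser; have [->|m0] := posnP m.
  by rewrite !lamb0 !subr0 addr0.
rewrite !lambE // /esum5 rmorph_sum /= -big_split -!sumrB /=.
apply: eq_bigr => d dm; rewrite /resc /chi5 rmorphM /=.
have md : (0 < m %/ d)%N by rewrite divn_gt0 ?(dvdn_leq m0 dm) // (dvdn_gt0 m0 dm).
have z0 : (0 : K) ^+ (m %/ d) = 0 by rewrite expr0n gtn_eqF.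
have := ltn_pmod d (isT : 0 < 5)%N.
by move: (d %% 5)%N => [|[|[|[|[|]]]]] // _; rewrite /= ?z0 ?expr1n; ring.
Qed.

Theorem E_product : f5 K * (1 - 5%:R * Eser) = f1 K ^+ 5.
Proof.
apply: (ps_mulfI (eul_neq0 (fun=> 1))); rewrite -/(f1 K).
have W := wronskian_AB K_char0; rewrite cubE in W.
have dA : pder (thA K) = - (thA K * (lamb (resc 5 5 1) + lamb (resc 5 2 1) + lamb (resc 5 3 1))).
  by rewrite thAE !pderM !pder_eul; ring.
have dB : pder (thB K) = - (thB K * (lamb (resc 5 5 1) + lamb (resc 5 1 1) + lamb (resc 5 4 1))).
  by rewrite thBE !pderM !pder_eul; ring.
transitivity (f1 K ^+ 3 ^+ 2); last by ring.
rewrite -W dA dB -lamb_resc5 mulrA -thAB; ring.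
Qed.

Section FifthRoot.
Variable z : K.
Hypothesis z_sum : 1 + z + z ^+ 2 + z ^+ 3 + z ^+ 4 = 0.

Lemma z5 : z ^+ 5 = 1.
Proof.
apply/eqP; rewrite -subr_eq0; apply/eqP.
transitivity ((z - 1) * (1 + z + z ^+ 2 + z ^+ 3 + z ^+ 4)); first by ring.
by rewrite z_sum mulr0.
Qed.

Lemma z_neq0 : z != 0.
Proof. by apply: contraTneq (oner_neq0 K) => z0; rewrite -z5 z0 expr0n eqxx. Qed.

Lemma zV : z^-1 = z ^+ 4.
Proof. by apply: (mulfI z_neq0); rewrite divff ?z_neq0 // -exprS z5. Qed.

Lemma zsum_step n : zsum z (n + 5) = zsum z n.
Proof.
rewrite !addnS addn0 /= -!exprVn zV -!exprM.
transitivity (zsum z n + z ^+ n * z * (1 + z + z ^+ 2 + z ^+ 3 + z ^+ 4)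
   + (z ^+ (4 * n.+1) + z ^+ (4 * n.+2) + z ^+ (4 * n.+3) + z ^+ (4 * n.+4)
      + z ^+ (4 * n.+4.+1))); first by rewrite !exprS; ring.
have -> : z ^+ (4 * n.+1) + z ^+ (4 * n.+2) + z ^+ (4 * n.+3) + z ^+ (4 * n.+4)
      + z ^+ (4 * n.+4.+1)
  = z ^+ (4 * n) * (z ^+ 4 + z ^+ 5 * z ^+ 3 + (z ^+ 5) ^+ 2 * z ^+ 2
     + (z ^+ 5) ^+ 3 * z + (z ^+ 5) ^+ 4).
  rewrite !mulnS !exprD; ring.
rewrite z5 z_sum mulr0 addr0 !expr1n.
rewrite (_ : z ^+ 4 + _ + _ + _ + _ = 1 + z + z ^+ 2 + z ^+ 3 + z ^+ 4); last by ring.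
by rewrite z_sum mulr0 addr0.
Qed.

Lemma zsum_mod n : zsum z n = zsum z (n %% 5).
Proof.
rewrite {1}(divn_eq n 5); elim: (n %/ 5)%N => [|k IHk] //.
by rewrite mulSn -addnA addnC zsum_step.
Qed.

Lemma zsum_small : [/\ zsum z 0 = 1, zsum z 1 = 1 + z + z ^+ 4, zsum z 2 = 0,
  zsum z 3 = - (1 + z + z ^+ 4) & zsum z 4 = -1].
Proof.
have e6 : z ^+ 6 = z by rewrite exprS z5 mulr1.
have e8 : z ^+ 8 = z ^+ 3 by rewrite (exprD z 5 3) z5 mul1r.
have e12 : z ^+ 12 = z ^+ 2 by rewrite (exprM z 6 2) e6.
have e16 : z ^+ 16 = z by rewrite (exprD z 12 4) e12 -exprD e6.
have eq0 (x y : K) : x - y = 1 + z + z ^+ 2 + z ^+ 3 + z ^+ 4 -> x = y.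
  by rewrite z_sum => /eqP; rewrite subr_eq0 => /eqP.
have e2 : zsum z 2 = 0.
  by apply: eq0; rewrite /= -!exprVn zV -!exprM e8; ring.
have e3 : zsum z 3 = - (1 + z + z ^+ 4).
  by apply: eq0; rewrite [zsum z 3]/= -[zsum z 1 + _ + _]/(zsum z 2) e2
     -!exprVn zV -!exprM e12; ring.
split=> //; first by rewrite /= -!exprVn zV -!exprM expr1; ring.
rewrite [zsum z 4]/= -[zsum z 2 + _ + _]/(zsum z 3) e3 -!exprVn zV -!exprM e16.
ring.
Qed.

(** [zsum z] has period 5 and vanishes at n = 2 modulo 5. The classes 0 and 4 are the halves j >= 0
    and j < 0 of A(q^5), the classes 1 and 3 those of q B(q^5). *)
Lemma zsum_dissect :
  gf setT tri (fun n => (-1) ^+ n * zsum z n)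
  = psub 5 (thA K) - psC (1 + z + z ^+ 4) * (qX 1 * psub 5 (thB K)).
Proof.
have [s0 s1 s2 s3 s4] := zsum_small.
have triE n : (2 * tri n = n * n.+1)%N.
  by rewrite /tri; have := @thEP 1 1 0 n.+1 erefl; rewrite /= ; lia.
have pt : proper_map tri.
  by apply: (proper_leq proper_id) => n; have := triE n; nia.
pose D := [set n | (n %% 5 = 0 \/ n %% 5 = 4)%N].
pose D' := [set n | (n %% 5 = 1 \/ n %% 5 = 3)%N].
have sgnE m n : (m = n %[mod 2])%N -> (-1) ^+ m = (-1) ^+ n :> K.
  by rewrite -(signr_odd _ m) -(signr_odd _ n) => e; congr (_ ^+ _); lia.
rewrite (gf_split D) // [X in _ + X](gf_split D') //.
have -> : gf ([set: nat] `&` D) tri (fun n => (-1) ^+ n * zsum z n) = psub 5 (thA K).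
  pose h (j : int) : nat := match j with Posz n => 5 * n | Negz n => 5 * n + 4 end%N.
  rewrite gf_sub // (@gf_reindex _ _ _ h setT).
  - apply: eq_gf => -[n|n] _ /=.
    + by have := triE (5 * n)%N; have := @thEP 5 2 3 n erefl; rewrite /=; nia.
    + by have := triE (5 * n + 4)%N; have := @thEP 5 2 3 (Negz n) erefl;
        rewrite NegzE /=; nia.
    + rewrite zsum_mod (_ : (5 * n) %% 5 = 0)%N; last by lia.
      by rewrite s0 mulr1; apply: sgnE; lia.
    rewrite zsum_mod (_ : (5 * n + 4) %% 5 = 4)%N; last by lia.
    rewrite s4 mulrN1 exprS mulN1r; congr (- _); apply: sgnE; lia.
  - by move=> [n|n] _; split=> //=; rewrite /D /=; lia.
  - by move=> [m|m] [n|n] _ _ /=; lia.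
  move=> n [_ [] hn]; first by exists (Posz (n %/ 5)%N) => //=; lia.
  by exists (Negz (n %/ 5)%N) => //=; lia.
have -> : gf ([set: nat] `&` ~` D `&` D') tri (fun n => (-1) ^+ n * zsum z n)
    = - (psC (1 + z + z ^+ 4) * (qX 1 * psub 5 (thB K))).
  pose h (j : int) : nat := match j with Posz n => 5 * n + 1 | Negz n => 5 * n + 3 end%N.
  rewrite gf_sub // gf_shift -[RHS]mulNr -psCN -gf_scale.
  rewrite (@gf_reindex _ _ _ h setT).
  - apply: eq_gf => -[n|n] _ /=.
    + by have := triE (5 * n + 1)%N; have := @thEP 5 1 4 n erefl; rewrite /=; nia.
    + by have := triE (5 * n + 3)%N; have := @thEP 5 1 4 (Negz n) erefl;
        rewrite NegzE /=; nia.
    + rewrite zsum_mod (_ : (5 * n + 1) %% 5 = 1)%N; last by lia.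
      rewrite s1 (@sgnE _ n.+1); last by lia.
      by rewrite exprS; ring.
    rewrite zsum_mod (_ : (5 * n + 3) %% 5 = 3)%N; last by lia.
    rewrite s3 (@sgnE _ n.+1); last by lia.
    by rewrite exprS; ring.
  - by move=> [n|n] _; split=> //=; rewrite /D /D' /=; lia.
  - by move=> [m|m] [n|n] _ _ /=; lia.
  move=> n [_ [] hn]; first by exists (Posz (n %/ 5)%N) => //=; lia.
  by exists (Negz (n %/ 5)%N) => //=; lia.
rewrite [X in _ + (_ + X)](_ : _ = 0) ?addr0 //.
rewrite (@eq_gf _ _ _ _ tri _ (fun=> 0)) //.
  by apply/funext => m; rewrite /gf fsbig1.
move=> n [[_ nD] nD']; rewrite zsum_mod (_ : (n %% 5 = 2)%N) ?s2 ?mulr0 //.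
by rewrite /D /D' /= in nD nD'; lia.
Qed.

End FifthRoot.

Theorem C_product (z : K) : 1 + z + z ^+ 2 + z ^+ 3 + z ^+ 4 = 0 ->
  f1 K * Cser = qX 1 * f5 K ^+ 5.
Proof.
move=> z_sum.
have z2_sum : 1 + z ^+ 2 + (z ^+ 2) ^+ 2 + (z ^+ 2) ^+ 3 + (z ^+ 2) ^+ 4 = 0.
  rewrite -!exprM (exprD z 5 1) (exprD z 5 3) (z5 z_sum) -[RHS]z_sum; ring.
(* The quadratic Gauss sum of [chi5]. *)
pose g := z + z ^+ 4 - z ^+ 2 - z ^+ 3.
have g2 : g * g = 5%:R.
  (* The cofactor is the quotient of g^2 - 5 by the fifth cyclotomic polynomial. *)
  transitivity (5%:R + (z ^+ 4 - 3%:R * z ^+ 3 + z ^+ 2 + 5%:R * z - 5%:R)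
    * (1 + z + z ^+ 2 + z ^+ 3 + z ^+ 4)); first by rewrite /g; ring.
  by rewrite z_sum mulr0 addr0.
have g_neq0 : g != 0.
  by apply: contra_neq (_ : 5%:R != 0 :> K) => [g0|]; [rewrite -g2 g0 mul0r | rewrite ((pcharf0P K).1 K_char0)].
pose a := f1 K * eul (fun=> z) * eul (fun=> z^-1).
pose b := f1 K * eul (fun=> z ^+ 2) * eul (fun=> (z ^+ 2)^-1).
pose T := psub 5 (thA K); pose U := qX 1 * psub 5 (thB K).
have aE : a = T - psC (1 + z + z ^+ 4) * U.
  by rewrite /a -theta_zsum ?zsum_dissect ?z_neq0.
have bE : b = T - psC (1 + z ^+ 2 + z ^+ 3) * U.
  rewrite /b -theta_zsum ?zsum_dissect ?z_neq0 // -exprM.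
  by rewrite (exprD z 5 3) z5 // mul1r.
have ab : a * b = f1 K * f5 K.
  have f1k i : eqmod i.+1 (psub 5 (eulF (fun=> 1 : K) i)) 1.
    apply: (@eqmodW _ _ (5 * i.+1)); first exact: leq_pmull.
    by rewrite -(psub1 K (isT : 0 < 5)%N); apply: eqmod_sub => //; apply: eulF1.
  have -> : a * b = \prod_(c <- [:: fun=> 1; fun=> 1; fun=> z; fun=> z^-1;
      fun=> z ^+ 2; fun=> (z ^+ 2)^-1]) eul c.
    by rewrite !big_cons big_nil /a /b /f1; ring.
  rewrite prod_eul /f5 /f1 /eul psub_pinf //; last exact: eulF1.
  rewrite -pinfM //; last exact: eulF1.
  apply: eq_pinf => i; rewrite !big_cons big_nil /eulF.
  rewrite psubB psub1 // psubM // psubC // psub_qX // psC1 mulnC -qXn !mul1r.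
  set X := qX i.+1; rewrite zV // -exprVn zV // -exprM.
  have e8 : z ^+ 8 = z ^+ 3 by rewrite (exprD z 5 3) z5 // mul1r.
  have e6 : z ^+ 6 = z by rewrite exprS z5 // mulr1.
  have h1 : psC z * psC (z ^+ 4) = 1 by rewrite -psCM -exprS z5.
  have h2 : psC (z ^+ 2) * psC (z ^+ 3) = 1 by rewrite -psCM -exprD z5.
  have h3 : (psC z + psC (z ^+ 4)) + (psC (z ^+ 2) + psC (z ^+ 3)) = -1.
    rewrite -!psCD -psC1 -psCN; congr psC; apply/eqP; rewrite -subr_eq0 opprK.
    by apply/eqP; rewrite -z_sum; ring.
  have h4 : (psC z + psC (z ^+ 4)) * (psC (z ^+ 2) + psC (z ^+ 3)) = -1.
    rewrite -!psCD -psCM -psC1 -psCN; congr psC.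
    transitivity (z ^+ 3 + z ^+ 4 + z ^+ 6 + z ^+ 5 * z ^+ 2); first by ring.
    apply/eqP; rewrite e6 z5 // -subr_eq0 opprK; apply/eqP; rewrite -z_sum; ring.
  rewrite e8.
  transitivity ((1 - X) * (1 - X) * (1 - (psC z + psC (z ^+ 4)) * X
      + psC z * psC (z ^+ 4) * X ^+ 2) * (1 - (psC (z ^+ 2) + psC (z ^+ 3)) * X
      + psC (z ^+ 2) * psC (z ^+ 3) * X ^+ 2)); first by ring.
  rewrite h1 h2.
  move: h3 h4; set s := psC z + _; set t := psC _ + _ => h3 h4.
  transitivity ((1 - X) ^+ 2 * ((1 + X ^+ 2) ^+ 2 - (s + t) * X * (1 + X ^+ 2)
     + s * t * X ^+ 2)); first by ring.
  by rewrite h3 h4; ring.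
have Da : pder a = - (a * (lamb (fun=> 1) + lamb (fun=> z) + lamb (fun=> z^-1))).
  by rewrite /a /f1 !pderM !pder_eul; ring.
have Db : pder b = - (b * (lamb (fun=> 1) + lamb (fun=> z ^+ 2) + lamb (fun=> (z ^+ 2)^-1))).
  by rewrite /b /f1 !pderM !pder_eul; ring.
(* For every k, z^k + z^(-k) - z^(2k) - z^(-2k) = chi(k) g. *)
have lg : lamb (fun=> z) + lamb (fun=> z^-1) - lamb (fun=> z ^+ 2)
    - lamb (fun=> (z ^+ 2)^-1) = psC g * Cser.
  apply/funext => m; rewrite psCM_coef !psB psD /Cser; have [->|m0] := posnP m.
    by rewrite !lamb0 !subr0 addr0 mulr0.
  rewrite !lambE // /csum rmorph_sum /= mulr_sumr -big_split -!sumrB /=.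
  apply: eq_bigr => d dm; rewrite rmorphM /=.
  have zm n : z ^+ n = z ^+ (n %% 5).
    by rewrite {1}(divn_eq n 5) exprD mulnC exprM z5 // expr1n mul1r.
  rewrite zV // -exprVn zV // -!exprM (mulnA 4 2) /chi5.
  rewrite (zm (m %/ d)%N) (zm (4 * _)%N) (zm (2 * _)%N) (zm (4 * 2 * _)%N).
  rewrite -(modnMmr 4) -(modnMmr 2) -(modnMmr (4 * 2)).
  have := ltn_pmod (m %/ d) (isT : 0 < 5)%N.
  by move: (m %/ d %% 5)%N => [|[|[|[|[|]]]]] // _; rewrite /g /=; ring.
have W := wronskian_AB K_char0; rewrite cubE in W.
(* This is [wronskian_AB] at q^5: its summand AB is what the derivative of the factor q in U = q
   B(q^5) contributes. *)
have TU : T * pder U - U * pder T = qX 1 * f5 K ^+ 6.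
  have -> : f5 K ^+ 6 = psub 5 (f1 K ^+ 3 ^+ 2) by rewrite -exprM psubX.
  have ps5 : psub 5 (5%:R : ps K) = 5%:R by rewrite -psC_nat psubC.
  rewrite -W /T /U pderM pder_qX !pder_sub // psubD psubM // psubM // ps5 psubB !psubM //.
  by ring.
(* Both sides are the Wronskian of a and b: once as a b times a difference of logarithmic
   derivatives, once from a and b being T minus constant multiples of U, the two constants differing
   by g. *)
have main : f1 K * f5 K * (psC g * Cser) = psC g * (qX 1 * f5 K ^+ 6).
  rewrite -TU -ab -lg.
  transitivity (a * pder b - b * pder a); first by rewrite Da Db; ring.
  rewrite aE bE !pderD !pderN !pder_CM.
  have -> : psC g = psC (1 + z + z ^+ 4) - psC (1 + z ^+ 2 + z ^+ 3).
    by rewrite -psCN -psCD; congr psC; rewrite /g; ring.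
  by ring.
apply: (@ps_mulfI _ (f5 K * psC g)).
  apply: contra g_neq0 => /eqP e.
  have f5n : f5 K != 0 by apply: psub_neq0 => //; apply: eul_neq0.
  have := congr1 (fun f : ps K => f 0%N) (ps_mulf_eq0 e f5n).
  by rewrite /psC mulr1n => ->.
transitivity (f1 K * f5 K * (psC g * Cser)); first by ring.
by rewrite main; ring.
Qed.

End Eisenstein.

(** * The coefficients of psi(-q^5)^5 / psi(-q) *)

Section Assembly.
Local Open Scope classical_set_scope.
Variable K : fieldType.
Hypothesis K_char0 : [pchar K] =i pred0.

Lemma psub2_f1 : psub 2 (f1 K) = f1 K * g1 K.
Proof. by rewrite r0_sub r0E. Qed.

Lemma psub2_f5 : psub 2 (f5 K) = f5 K * g5 K.
Proof.
by rewrite /f5 psub_psub // -[(2 * 5)%N]/(5 * 2)%N -psub_psub // psub2_f1 psubM.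
Qed.

Lemma natr_ps_neq0 n : (n.+1%:R : ps K) != 0.
Proof.
rewrite -psC_nat; apply: (@ps_neq0 _ _ 0); rewrite /psC mulr1n.
by rewrite ((pcharf0P K).1 K_char0).
Qed.

Lemma mul_ps_neq0 (f g : ps K) : f != 0 -> g != 0 -> f * g != 0.
Proof. by move=> f0; apply: contra_neq => /ps_mulf_eq0; apply. Qed.

Lemma expr_ps_neq0 (f : ps K) n : f != 0 -> f ^+ n != 0.
Proof.
move=> f0; elim: n => [|n IHn]; first by rewrite expr0 oner_neq0.
by rewrite exprS; apply: mul_ps_neq0.
Qed.

Theorem psi_quotient (z : K) : 1 + z + z ^+ 2 + z ^+ 3 + z ^+ 4 = 0 ->
  psi K * (Cser K - 3%:R * psub 2 (Cser K) - Eser K + psub 2 (Eser K))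
  = 4%:R * (qX 3 * psub 5 (psi K) ^+ 5).
Proof.
move=> z_sum; pose q : ps K := qX 1.
have q3 : (qX 3 : ps K) = q ^+ 3 by rewrite /q qXn.
have hC := C_product K_char0 z_sum; have hE := E_product K_char0.
have nat2 n : psub 2 (n%:R : ps K) = n%:R by rewrite -psC_nat psubC.
have hC2 : f1 K * g1 K * psub 2 (Cser K) = q ^+ 2 * (f5 K * g5 K) ^+ 5.
  by rewrite -psub2_f1 -psub2_f5 -psubM // hC psubM // psub_qX // psubX // /q qXn.
have hE2 : f5 K * g5 K * (1 - 5%:R * psub 2 (Eser K)) = (f1 K * g1 K) ^+ 5.
  by rewrite -psub2_f1 -psub2_f5 -psubX // -hE psubM // psubB psubM // psub1 // nat2.
have hpsi5 : psub 5 (psi K) = f5 K * g5 K * g5 K by rewrite psiE !psubM.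
have hphi5 : psub 5 (phi K) * g5 K = f5 K by rewrite -psubM // phiE.
have h1 := psi_quadratic K; have h2 := phi_quadratic K_char0.
have hPQ := thPQ K; have h79 := th79 K; have hphi := phiE K.
rewrite -/q in h2; rewrite hpsi5 psiE in h1; rewrite hpsi5 psiE q3 -/q in h1 hC *.
have Y_neq0 : g5 K != 0 by apply: psub_neq0 => //; apply: eul_neq0.
have b_neq0 : f5 K != 0 by apply: psub_neq0 => //; apply: eul_neq0.
move: (Cser K) (Eser K) (psub 2 (Cser K)) (psub 2 (Eser K)) hC hE hC2 hE2.
move=> C E C2 E2 hC hE hC2 hE2.
move: (f1 K) (f5 K) (g1 K) (g5 K) (phi K) (psub 5 (phi K)) (thP K * thQ K)
  (th7 K * th9 K) hC hE hC2 hE2 hphi5 h1 h2 hPQ h79 hphi Y_neq0 b_neq0 {hpsi5}.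
move=> a b X Y ph ph5 PQ t79 hC hE hC2 hE2 hphi5 h1 h2 hPQ h79 hphi Y_neq0 b_neq0.
pose w := q * Y ^+ 5.
have i1 : a ^+ 2 * X ^+ 4 * Y = b ^+ 2 * (X + w).
  transitivity ((a * X * X) ^+ 2 * Y); first by ring.
  rewrite h1 mulrDl hPQ /w; ring.
have i2 : a ^+ 2 * Y ^+ 2 = b ^+ 2 * X * (X - 4%:R * w).
  transitivity (ph ^+ 2 * (X ^+ 2 * Y ^+ 2)); first by rewrite -hphi; ring.
  rewrite h2; transitivity ((ph5 * Y) ^+ 2 * X ^+ 2 - 4%:R * q * (t79 * X) * X * Y ^+ 2).
    by ring.
  by rewrite hphi5 h79 /w; ring.
(* Eliminating a between i1 and i2 and cancelling b leaves a relation between f_2/f_1 = X, f_10/f_5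
   = Y and w = q Y^5 alone. *)
have i3 : Y * (X + w) = X ^+ 5 * (X - 4%:R * w).
  apply: (ps_mulfI (expr_ps_neq0 2 b_neq0)).
  transitivity (b ^+ 2 * (X + w) * Y); first by ring.
  rewrite -i1; transitivity (X ^+ 4 * (a ^+ 2 * Y ^+ 2)); first by ring.
  by rewrite i2; ring.
(* The factor 5 (the index is its predecessor) lets E enter as 1 - 5 E, the quantity that
   [E_product] evaluates; b and Y^7 make the product formulas and i2 applicable. *)
apply: (ps_mulfI (natr_ps_neq0 4)).
apply: (ps_mulfI b_neq0); apply: (ps_mulfI (expr_ps_neq0 7 Y_neq0)).
transitivity (Y ^+ 6 * (5%:R * b * Y * X ^+ 2 * (a * C)
   - 15%:R * b * Y * X * (a * X * C2)
   + a * X ^+ 2 * (Y * (b * (1 - 5%:R * E)) - b * Y * (1 - 5%:R * E2)))).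
  by ring.
rewrite hC hC2 hE hE2.
transitivity (b ^+ 6 * Y ^+ 2 * (5%:R * w * X ^+ 2 - 15%:R * w ^+ 2 * X)
  + (a ^+ 2 * Y ^+ 2) ^+ 3 * (X ^+ 2 * (Y - X ^+ 5))); first by rewrite /w; ring.
rewrite i2.
transitivity (b ^+ 6 * Y ^+ 2 * (5%:R * w * X ^+ 2 - 15%:R * w ^+ 2 * X)
  + b ^+ 6 * (X - 4%:R * w) * (X ^+ 5 * (X - 4%:R * w)) * ((X - 4%:R * w) * Y
     - X ^+ 5 * (X - 4%:R * w))); first by ring.
rewrite -i3 /w; ring.
Qed.

Definition ps_int (a : nat -> int) : ps K := fun n => (a n)%:~R.
(** The substitution q -> -q, which exchanges psi(-q) and psi(q). *)
Definition twist (f : ps K) : ps K := fun n => (-1) ^+ n * f n.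

Lemma twistM f g : twist (f * g) = twist f * twist g.
Proof.
apply/funext => n; rewrite /twist !psM mulr_sumr; apply: eq_bigr => i _.
by rewrite mulrACA -exprD subnKC // leq_ord.
Qed.

Lemma twist1 : twist 1 = 1.
Proof. by apply/funext => -[|n]; rewrite /twist ps1 ?mul1r // mulr0. Qed.

Lemma twistX f n : twist (f ^+ n) = twist f ^+ n.
Proof. by elim: n => [|n IHn]; rewrite ?twist1 // !exprS twistM IHn. Qed.

Lemma twist_sub5 f : twist (psub 5 f) = psub 5 (twist f).
Proof.
apply/funext => n; rewrite /twist /psub; case: ifPn => [/dvdnP[m ->]|_].
  by rewrite mulnK // -signr_odd oddM andbT signr_odd.
by rewrite mulr0.
Qed.

Lemma ps_intM a b : ps_int (fps_mul a b) = ps_int a * ps_int b.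
Proof.
apply/funext => n; rewrite psM /ps_int /fps_mul rmorph_sum /=.
by apply: eq_bigr => i _; rewrite rmorphM.
Qed.

Lemma ps_intX a n : ps_int (fps_exp a n) = ps_int a ^+ n.
Proof.
elim: n => [|n IHn]; last by rewrite exprS -IHn -ps_intM.
by apply/funext => -[|m].
Qed.

Lemma ps_int_sub k a : ps_int (fps_subX k a) = psub k (ps_int a).
Proof. by apply/funext => n; rewrite /ps_int /fps_subX /psub; case: ifP. Qed.

Lemma twist_psiN : twist (ps_int psiN) = psi K.
Proof.
have triE n : ((n * n.+1)./2 = tri n)%N by rewrite /tri bin2 /= mulnC.
have -> : psi K = sinf (fun n => psC 1 * qX (tri n)).
  by rewrite sinf_gf // => n; rewrite /tri binS bin1 leq_addl.
apply/funext => m; rewrite /twist /ps_int /psiN /sinf ps_sum rmorph_sum /=.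
rewrite mulr_sumr [LHS]big_mkcond; apply: eq_bigr => n _.
rewrite triE psC1 mul1r /qX eq_sym; case: eqP => // <-.
by rewrite rmorphXn rmorphN1 -expr2 sqrr_sign.
Qed.

Lemma twist_bbar5 : twist (ps_int bbar5) * psi K = psub 5 (psi K) ^+ 5.
Proof.
rewrite -twist_psiN -twistM -ps_intM.
have -> : fps_mul bbar5 psiN = fps_exp (fps_subX 5 psiN) 5.
  by apply/funext => n; apply: bbar5P.
by rewrite ps_intX twistX ps_int_sub twist_sub5.
Qed.

End Assembly.

Definition half_term (f : nat -> int) (m : nat) : int :=
  if (2 %| m)%N then f (m %/ 2)%N else 0.

Theorem bbar5_formula n :
  4 * ((-1) ^+ n * bbar5 n) = csum (n + 3) - 3 * half_term csum (n + 3)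
    - esum5 (n + 3) + half_term esum5 (n + 3).
Proof.
(* The identity between integers is obtained in the algebraic numbers, which contain a primitive
   fifth root of unity. *)
have [z z_prim] := C_prim_root_exists (isT : 0 < 5)%N.
have z_sum : 1 + z + z ^+ 2 + z ^+ 3 + z ^+ 4 = 0.
  apply: (mulfI (_ : z - 1 != 0)).
    by have := eq_prim_root_expr z_prim 1 0; rewrite expr1 expr0 subr_eq0 => ->.
  transitivity (z ^+ 5 - 1); first by ring.
  by rewrite prim_expr_order // subrr mulr0.
have K0 := Num.Theory.pchar_num algC.
have psi0 : psi algC != 0.
  rewrite psiE; apply: mul_ps_neq0; last exact: eul_neq0.
  by apply: mul_ps_neq0; apply: eul_neq0.
have := psi_quotient K0 z_sum; rewrite -twist_bbar5.
rewrite [_ * psi _]mulrC [qX 3 * _]mulrCA [4%:R * _]mulrCA => /(ps_mulfI psi0).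
move=> /(congr1 (fun f : ps algC => f (n + 3)%N)).
rewrite -[3%:R]psC_nat -[4%:R]psC_nat psD !psB !psCM_coef qXM leq_addl addnK.
rewrite /twist /ps_int /psub /Cser /Eser addn3 /= -addn3 => e.
apply: (@intr_inj algC).
rewrite rmorphM rmorphM rmorphXn rmorphN1 /= -e.
rewrite !(rmorphD, rmorphN, rmorphM) /= /half_term.
case: ifPn => [/dvdnP[k ek]|_]; last by ring.
have k_gt0 : (0 < k)%N by lia.
by rewrite ek mulnK // k_gt0; ring.
Qed.

(** * Signs of the coefficients *)

Definition dsum (f : nat -> int) (m : nat) : int := \sum_(d <- divisors m) f d.

Lemma dsumE (f : nat -> int) m : (0 < m)%N ->
  \sum_(d < m.+1 | (d %| m)%N) f d = dsum f m.
Proof.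
move=> m0; rewrite -(big_mkord (fun d => d %| m)%N f) -big_filter /dsum.
apply: perm_big; apply: uniq_perm; rewrite ?filter_uniq ?iota_uniq ?divisors_uniq //.
move=> d; rewrite mem_filter mem_index_iota /= ltnS -dvdn_divisors //.
by rewrite andb_idr // => /dvdn_leq; apply.
Qed.

Lemma dsum_primeM p f m : prime p -> (0 < m)%N ->
  dsum f (p * m) = dsum (fun d => f (p * d)%N) m
                   + \sum_(d <- divisors (p * m) | ~~ (p %| d)%N) f d.
Proof.
move=> p_pr m0; have p0 := prime_gt0 p_pr.
rewrite /dsum (bigID (fun d => p %| d)%N) /=; congr (_ + _).
rewrite -big_filter -(big_map (muln p) xpredT f); apply: perm_big.
apply: uniq_perm; first by rewrite filter_uniq // divisors_uniq.
  rewrite map_inj_uniq ?divisors_uniq // => x y /eqP.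
  by rewrite eqn_pmul2l // => /eqP.
move=> d; rewrite mem_filter -dvdn_divisors ?muln_gt0 ?p0 //.
apply/andP/mapP => [[/dvdnP[k ->]]|[k]].
  rewrite [(k * p)%N]mulnC dvdn_pmul2l // => km.
  by exists k; [rewrite -dvdn_divisors|].
by rewrite -dvdn_divisors // => km ->; rewrite dvdn_mulr // dvdn_pmul2l.
Qed.

Lemma sum_coprime_part p k f n : prime p -> (0 < n)%N -> ~~ (p %| n)%N ->
  \sum_(d <- divisors (p * (p ^ k * n)) | ~~ (p %| d)%N) f d = dsum f n.
Proof.
move=> p_pr n0 pn; have p0 := prime_gt0 p_pr.
rewrite -big_filter /dsum; apply: perm_big; apply: uniq_perm.
- by rewrite filter_uniq // divisors_uniq.
- exact: divisors_uniq.
move=> d; rewrite mem_filter -!dvdn_divisors ?muln_gt0 ?expn_gt0 ?p0 //.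
rewrite mulnA -expnS; apply/andP/idP => [[pd]|dn].
  by rewrite Gauss_dvdr // coprime_sym coprime_pexpl // prime_coprime.
by split; [apply: contra pn => /dvdn_trans; apply | apply: dvdn_mull].
Qed.

Lemma chi5M m n : chi5 (m * n) = chi5 m * chi5 n.
Proof.
rewrite /chi5 -modnMm.
have := ltn_pmod m (isT : 0 < 5)%N; have := ltn_pmod n (isT : 0 < 5)%N.
by case: (m %% 5)%N => [|[|[|[|[|]]]]] //; case: (n %% 5)%N => [|[|[|[|[|]]]]].
Qed.

Lemma chi5_cases m : [\/ chi5 m = 0, chi5 m = 1 | chi5 m = -1].
Proof.
rewrite /chi5; have := ltn_pmod m (isT : 0 < 5)%N.
by case: (m %% 5)%N => [|[|[|[|[|]]]]] // _; do ?[by constructor].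
Qed.

Lemma chi5_eq0 m : (chi5 m == 0) = (5 %| m)%N.
Proof.
rewrite /chi5 /dvdn; have := ltn_pmod m (isT : 0 < 5)%N.
by case: (m %% 5)%N => [|[|[|[|[|]]]]].
Qed.

Lemma csumE m : (0 < m)%N -> csum m = dsum (fun d => chi5 (m %/ d) * d%:Z) m.
Proof. exact: dsumE. Qed.
Lemma esum5E m : (0 < m)%N -> esum5 m = dsum (fun d => chi5 d * d%:Z) m.
Proof. exact: dsumE. Qed.

Lemma eq_dsum f g m : (0 < m)%N -> (forall d, (d %| m)%N -> f d = g d) ->
  dsum f m = dsum g m.
Proof.
by move=> m0 fg; apply: eq_big_seq => d; rewrite -dvdn_divisors //; apply: fg.
Qed.

Lemma dsum_scale c f m : dsum (fun d => c * f d) m = c * dsum f m.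
Proof. by rewrite /dsum mulr_sumr. Qed.

(** Divisors p d have the same cofactor as d in p^k n; the divisors prime to p are those of n, with
    cofactor multiplied by p^(k+1). *)
Lemma csum_step p k n : prime p -> (0 < n)%N -> ~~ (p %| n)%N ->
  csum (p ^ k.+1 * n) = p%:Z * csum (p ^ k * n) + chi5 p ^+ k.+1 * csum n.
Proof.
move=> p_pr n0 pn; have p0 := prime_gt0 p_pr.
have pk0 j : (0 < p ^ j * n)%N by rewrite muln_gt0 expn_gt0 p0.
rewrite !csumE // expnS -mulnA dsum_primeM // sum_coprime_part //.
rewrite -!dsum_scale; congr (_ + _); apply: eq_dsum => // d dn.
  by rewrite divnMl // PoszM; ring.
rewrite mulnA -expnS -muln_divA // chi5M.
have -> : chi5 (p ^ k.+1) = chi5 p ^+ k.+1.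
  by elim: k.+1 => [|j IHj] //; rewrite expnS chi5M IHj exprS.
by rewrite mulrA.
Qed.

Lemma esum5_step p k n : prime p -> (0 < n)%N -> ~~ (p %| n)%N ->
  esum5 (p ^ k.+1 * n) = chi5 p * p%:Z * esum5 (p ^ k * n) + esum5 n.
Proof.
move=> p_pr n0 pn; have p0 := prime_gt0 p_pr.
have pk0 j : (0 < p ^ j * n)%N by rewrite muln_gt0 expn_gt0 p0.
rewrite !esum5E // expnS -mulnA dsum_primeM // sum_coprime_part //.
rewrite -!dsum_scale; congr (_ + _); apply: eq_dsum => // d dn.
by rewrite chi5M PoszM; ring.
Qed.

Lemma csum_5M m : (0 < m)%N -> csum (5 * m) = 5 * csum m.
Proof.
move=> m0; rewrite !csumE ?muln_gt0 // dsum_primeM // [X in _ + X]big1_seq ?addr0.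
  rewrite -dsum_scale; apply: eq_dsum => // d dm.
  by rewrite divnMl // PoszM; ring.
move=> d /andP[nd]; rewrite -dvdn_divisors ?muln_gt0 // => d5m.
have dm : (d %| m)%N by rewrite -(@Gauss_dvdr _ 5) // coprime_sym prime_coprime.
by rewrite -muln_divA // chi5M mul0r mul0r.
Qed.

Lemma esum5_5M m : (0 < m)%N -> esum5 (5 * m) = esum5 m.
Proof.
move=> m0; rewrite !esum5E ?muln_gt0 // dsum_primeM //.
rewrite [X in X + _]big1_seq ?add0r; last by move=> d _; rewrite chi5M !mul0r.
rewrite /dsum [RHS](bigID (fun d => 5 %| d)%N) /= [X in X + _]big1 ?add0r; last first.
  by move=> d; rewrite -chi5_eq0 => /eqP ->; rewrite mul0r.
rewrite -!(big_filter (divisors _)); apply: perm_big.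
apply: uniq_perm; rewrite ?filter_uniq ?divisors_uniq // => d.
rewrite !mem_filter -!dvdn_divisors ?muln_gt0 //.
apply: andb_id2l => nd.
by rewrite Gauss_dvdr // coprime_sym prime_coprime.
Qed.

(** Remove one full prime power: for n prime to p, [csum_step] gives c(p^(k+1) n) >= 2 c(p^k n) -
    c(n), so c(p^k n) >= c(n) by induction on k. *)
Lemma csum_gt0 m : (0 < m)%N -> 0 < csum m.
Proof.
elim/ltn_ind: m => m IHm m0; have [m1|m1] := leqP m 1.
  have -> : m = 1%N by lia.
  by rewrite csumE // /dsum (_ : divisors 1 = [:: 1%N]) // big_seq1.
set p := pdiv m; have p_pr : prime p := pdiv_prime m1.
have [n pn em] := pfactor_coprime p_pr m0.
have n0 : (0 < n)%N by rewrite lt0n; apply: contraTneq m0 => n0; rewrite em n0.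
have np : ~~ (p %| n)%N by rewrite -prime_coprime.
have k0 : (0 < logn p m)%N by rewrite logn_gt0 mem_primes p_pr m0 pdiv_dvd.
have lt_nm : (n < m)%N.
  by rewrite [X in (_ < X)%N]em ltn_Pmulr // (ltn_exp2l 0) // prime_gt1.
have c0 := IHm n lt_nm n0.
rewrite em mulnC; move: (logn p m) => k; apply: (lt_le_trans c0).
elim: k => [|k IHk]; first by rewrite expn0 mul1n.
rewrite csum_step //.
have p2 : 2 <= p%:Z by have := prime_gt1 p_pr; lia.
have chik : - csum n <= chi5 p ^+ k.+1 * csum n.
  have [->|->|->] := chi5_cases p; rewrite ?expr0n ?expr1n ?mul0r ?mul1r; try lia.
  by rewrite -signr_odd; case: odd; rewrite ?expr0 ?expr1; lia.
nia.
Qed.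

(** For d dividing m, chi(m/d) is 1 or -1, hence chi(d) = chi(m) chi(m/d). *)
Lemma esum5_coprime m : (0 < m)%N -> ~~ (5 %| m)%N -> esum5 m = chi5 m * csum m.
Proof.
move=> m0 m5; rewrite esum5E // csumE // -dsum_scale; apply: eq_dsum => // d dm.
rewrite -{1}(divnK dm) chi5M.
have : chi5 (m %/ d) != 0.
  by rewrite chi5_eq0; apply: contra m5 => /dvdn_trans; apply; apply: dvdn_div.
by have [->|->|->] := chi5_cases (m %/ d) => // _; ring.
Qed.

Lemma esum5_le m : (0 < m)%N -> `|esum5 m| <= csum m.
Proof.
elim/ltn_ind: m => m IHm m0; have [/dvdnP[k ek]|n5] := boolP (5 %| m)%N.
  have k0 : (0 < k)%N by lia.
  have := IHm k; have := csum_gt0 k0.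
  rewrite ek mulnC csum_5M // esum5_5M //; lia.
rewrite esum5_coprime //; have c0 := csum_gt0 m0.
by have [->|->|->] := chi5_cases m; lia.
Qed.

Lemma esum5_lt m : (0 < m)%N -> (5 %| m)%N -> `|esum5 m| < csum m.
Proof.
move=> m0 /dvdnP[k ek]; have k0 : (0 < k)%N by lia.
rewrite ek mulnC csum_5M // esum5_5M //.
by have := esum5_le k0; have := csum_gt0 k0; lia.
Qed.

(** * Coefficients at 2^a N with N odd, for a up to 5 *)

Section TwoPart.
Variable N : nat.
Hypothesis N_odd : odd N.

Let N0 : (0 < N)%N. Proof. by case: N N_odd. Qed.
Let N2 : ~~ (2 %| N)%N. Proof. by rewrite dvdn2 N_odd. Qed.

Lemma csum_2 k : csum (2 ^ k.+1 * N) = 2 * csum (2 ^ k * N) + (-1) ^+ k.+1 * csum N.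
Proof. exact: csum_step. Qed.
Lemma esum5_2 k : esum5 (2 ^ k.+1 * N) = - 2 * esum5 (2 ^ k * N) + esum5 N.
Proof. exact: esum5_step. Qed.

Lemma half_term_2 f k : half_term f (2 ^ k.+1 * N) = f (2 ^ k * N)%N.
Proof. by rewrite /half_term expnS -mulnA dvdn_mulr // mulKn. Qed.

Definition fcoef (m : nat) : int :=
  csum m - 3 * half_term csum m - esum5 m + half_term esum5 m.

Lemma fcoef_2 :
  [/\ fcoef N = csum N - esum5 N,
      fcoef (2 * N) = - 2 * csum N + 2 * esum5 N,
      fcoef (4 * N) = - 4 * esum5 N &
      [/\ fcoef (8 * N) = - 4 * csum N + 8 * esum5 N,
          fcoef (16 * N) = - 4 * csum N - 16 * esum5 N &
          fcoef (32 * N) = - 12 * csum N + 32 * esum5 N]].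
Proof.
have e0 : (2 ^ 0 * N = N)%N by rewrite mul1n.
have fk k : fcoef (2 ^ k.+1 * N) = csum (2 ^ k.+1 * N) - 3 * csum (2 ^ k * N)
    - esum5 (2 ^ k.+1 * N) + esum5 (2 ^ k * N) by rewrite /fcoef !half_term_2.
split; first by rewrite /fcoef /half_term (negbTE N2); ring.
- by rewrite -[2%N]/(2 ^ 1)%N fk csum_2 esum5_2 e0; ring.
- by rewrite -[4%N]/(2 ^ 2)%N fk !csum_2 !esum5_2 e0; ring.
split.
- by rewrite -[8%N]/(2 ^ 3)%N fk !csum_2 !esum5_2 e0; ring.
- by rewrite -[16%N]/(2 ^ 4)%N fk !csum_2 !esum5_2 e0; ring.
by rewrite -[32%N]/(2 ^ 5)%N fk !csum_2 !esum5_2 e0; ring.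
Qed.

End TwoPart.

(** As chi(2) = -1, the residue of m = 2^a N modulo 5 fixes chi(N). Both cases amount to chi(N) = 1,
    where c - e vanishes; their densities 1/5 and 1/10 add up to exactly 30%. *)
Definition zero_class (m : nat) : bool :=
  (odd m && ((m %% 5 == 1) || (m %% 5 == 4)) ||
   (m %% 4 == 2) && ((m %% 5 == 2) || (m %% 5 == 3)))%N.

(** The valuations a = 0, 1, 2, 3 contribute 3/10, 3/20, 1/20 and 1/40, in total 52.5%; stopping at
    a = 2 would give 50%. *)
Definition pos_class (m : nat) : bool :=
  [|| odd m && ((m %% 5 == 0) || (m %% 5 == 2) || (m %% 5 == 3)),
      (m %% 4 == 2) && ((m %% 5 == 0) || (m %% 5 == 1) || (m %% 5 == 4)),
      (m %% 8 == 4) && ((m %% 5 == 1) || (m %% 5 == 4)) |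
      (m %% 16 == 8) && ((m %% 5 == 1) || (m %% 5 == 4))]%N.

(** The valuations 2 to 5 with chi(m) = -1 have density 3/32, short of 10%. The second class, m = 20
    k with k odd and chi(k) = -1, adds 1/100. The moduli 64 and 25 give the period 1600. *)
Definition neg_class (m : nat) : bool :=
  ([&& m %% 4 == 0, m %% 64 != 0 & (m %% 5 == 2) || (m %% 5 == 3)]
   || (m %% 8 == 4) && ((m %% 25 == 10) || (m %% 25 == 15)))%N.

Section Signs.
Variable n : nat.
Let m := (n + 3)%N.

Lemma bbar5_odd : odd m -> 4 * bbar5 n = fcoef m.
Proof.
rewrite /m => m_odd; rewrite /fcoef -bbar5_formula -signr_odd.
have -> : odd n = false by lia.
by rewrite expr0 mul1r.
Qed.

Lemma bbar5_even : ~~ odd m -> 4 * bbar5 n = - fcoef m.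
Proof.
rewrite /m => m_odd; rewrite /fcoef -bbar5_formula -signr_odd.
have -> : odd n = true by lia.
by rewrite expr1; ring.
Qed.

Lemma chi5_residue k : (((k %% 5 == 1) || (k %% 5 == 4))%N -> chi5 k = 1) *
  (((k %% 5 == 2) || (k %% 5 == 3))%N -> chi5 k = -1).
Proof.
rewrite /chi5; have := ltn_pmod k (isT : 0 < 5)%N.
by case: (k %% 5)%N => [|[|[|[|[|]]]]].
Qed.

Lemma bbar5_zero : zero_class m -> bbar5 n = 0.
Proof.
case/orP => /andP[h h5].
  have [e _ _ _] := fcoef_2 h; have := bbar5_odd h.
  rewrite e esum5_coprime; [|lia|lia].
  by rewrite (chi5_residue m).1 //; lia.
have [N eN] : exists N, m = (2 * N)%N by exists (m %/ 2)%N; lia.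
have N_odd : odd N by lia.
have := @bbar5_even; have [_ e _ _] := fcoef_2 N_odd.
rewrite eN e esum5_coprime; [|lia|lia].
by rewrite (chi5_residue N).1; lia.
Qed.

Lemma bbar5_pos : pos_class m -> 0 < bbar5 n.
Proof.
have c0 N : odd N -> 0 < csum N by move=> N_odd; apply: csum_gt0; case: N N_odd.
case/or4P => /andP[h h5].
- have [e _ _ _] := fcoef_2 h; have := bbar5_odd h; have := c0 _ h.
  have [m5|m5] := boolP (m %% 5 == 0)%N.
    by rewrite e; have := @esum5_lt m; rewrite /dvdn m5; lia.
  rewrite e esum5_coprime; [|lia|lia].
  by rewrite (chi5_residue m).2; lia.
- have [N eN] : exists N, m = (2 * N)%N by exists (m %/ 2)%N; lia.
  have N_odd : odd N by lia.
  have := @bbar5_even; have [_ e _ _] := fcoef_2 N_odd; have := c0 _ N_odd.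
  have [m5|m5] := boolP (N %% 5 == 0)%N.
    by rewrite eN e; have := @esum5_lt N; rewrite /dvdn m5; lia.
  rewrite eN e esum5_coprime; [|lia|lia].
  by rewrite (chi5_residue N).2; lia.
- have [N eN] : exists N, m = (4 * N)%N by exists (m %/ 4)%N; lia.
  have N_odd : odd N by lia.
  have := @bbar5_even; have [_ _ e _] := fcoef_2 N_odd; have := c0 _ N_odd.
  rewrite eN e esum5_coprime; [|lia|lia].
  by rewrite (chi5_residue N).1; lia.
have [N eN] : exists N, m = (8 * N)%N by exists (m %/ 8)%N; lia.
have N_odd : odd N by lia.
have := @bbar5_even; have [_ _ _ [e _ _]] := fcoef_2 N_odd; have := c0 _ N_odd.
rewrite eN e esum5_coprime; [|lia|lia].
by rewrite (chi5_residue N).2; lia.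
Qed.

Lemma bbar5_neg : neg_class m -> bbar5 n < 0.
Proof.
have c0 N : odd N -> 0 < csum N by move=> N_odd; apply: csum_gt0; case: N N_odd.
case/orP => [/and3P[h4 h64 h5]|/andP[h8 h25]]; last first.
  have [k ek] : exists k, m = (4 * (5 * k))%N by exists (m %/ 20)%N; lia.
  have k_odd : odd k by lia.
  have k5 : odd (5 * k) by rewrite oddM.
  have := @bbar5_even; have [_ _ e _] := fcoef_2 k5; have := c0 _ k_odd.
  rewrite ek e esum5_5M ?esum5_coprime; [|lia|lia|lia].
  by rewrite (chi5_residue k).2; lia.
have [a8|a8] := boolP (m %% 8 == 4)%N.
  have [N eN] : exists N, m = (4 * N)%N by exists (m %/ 4)%N; lia.
  have N_odd : odd N by lia.
  have := @bbar5_even; have [_ _ e _] := fcoef_2 N_odd; have := c0 _ N_odd.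
  rewrite eN e esum5_coprime; [|lia|lia].
  by rewrite (chi5_residue N).2; lia.
have [a16|a16] := boolP (m %% 16 == 8)%N.
  have [N eN] : exists N, m = (8 * N)%N by exists (m %/ 8)%N; lia.
  have N_odd : odd N by lia.
  have := @bbar5_even; have [_ _ _ [e _ _]] := fcoef_2 N_odd; have := c0 _ N_odd.
  rewrite eN e esum5_coprime; [|lia|lia].
  by rewrite (chi5_residue N).1; lia.
have [a32|a32] := boolP (m %% 32 == 16)%N.
  have [N eN] : exists N, m = (16 * N)%N by exists (m %/ 16)%N; lia.
  have N_odd : odd N by lia.
  have := @bbar5_even; have [_ _ _ [_ e _]] := fcoef_2 N_odd; have := c0 _ N_odd.
  rewrite eN e esum5_coprime; [|lia|lia].
  by rewrite (chi5_residue N).2; lia.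
have [N eN] : exists N, m = (32 * N)%N by exists (m %/ 32)%N; lia.
have N_odd : odd N by lia.
have := @bbar5_even; have [_ _ _ [_ _ e]] := fcoef_2 N_odd; have := c0 _ N_odd.
rewrite eN e esum5_coprime; [|lia|lia].
by rewrite (chi5_residue N).1; lia.
Qed.

End Signs.

(** * Densities *)

Lemma count_periodic (Q : pred nat) T a : (forall n, Q (n + T)%N = Q n) ->
  count Q (iota a T) = count Q (iota 0 T).
Proof.
move=> QT; elim: a => [|a <-] //.
(* One window of length T + 1 is counted twice: with its first element split off, and with its
   last. *)
have : count Q (iota a T.+1) = count Q (iota a T.+1) by [].
rewrite {1}[iota a T.+1]/= -[in RHS]addn1 iotaD count_cat /= QT addn0 addnC.
by move/addIn.
Qed.

Lemma count_periodic_ge (Q : pred nat) T a N : (forall n, Q (n + T)%N = Q n) ->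
  (N %/ T * count Q (iota 0 T) <= count Q (iota a N))%N.
Proof.
move=> QT; rewrite [in X in (_ <= X)%N](divn_eq N T) iotaD count_cat.
apply: leq_trans (leq_addr _ _).
elim: (N %/ T)%N a => [|k IHk] a //.
by rewrite !mulSn iotaD count_cat count_periodic // leq_add2l.
Qed.

Lemma lower_density_ge (R : realType) (P Q : pred nat) T : (0 < T)%N ->
  (forall n, Q (n + T)%N = Q n) -> (forall n, Q n -> P n) ->
  (((count Q (iota 0 T))%:R / T%:R : R)%:E <= lower_density R P)%E.
Proof.
move=> T0 QT QP; set c := count Q (iota 0 T).
have T0R : 0 < T%:R :> R by rewrite ltr0n.
(* Only complete periods are counted, and N/T exceeds their number by less than 1, so the proportion
   loses at most c/N. *)
have prop_ge N : (0 < N)%N -> c%:R / T%:R - c%:R / N%:R <= proportion R P N.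
  move=> N0; have N0R : 0 < N%:R :> R by rewrite ltr0n.
  rewrite /proportion ler_pdivlMr // mulrBl divfK ?gt_eqF //.
  have h : (N * c <= T * count P (iota 1 N) + T * c)%N.
    apply: (@leq_trans (T * (N %/ T * c) + T * c)).
      have := ltn_ceil N T0; nia.
    rewrite leq_add2r leq_mul2l; apply/orP; right.
    apply: leq_trans (count_periodic_ge 1 N QT) _.
    exact: sub_count.
  rewrite -(ler_pM2l T0R) mulrBr -!natrM mulrA mulrCA divff ?gt_eqF // mulr1.
  by rewrite -natrM lerBlDr -natrD ler_nat mulnC.
rewrite /lower_density limn_einf_lim.
set u := fun N => _; have -> : limn (einfs u) = ereal_sup (range (einfs u)).
  by apply/cvg_lim => //; apply: cvg_einfs_sup.
apply/lee_addgt0Pr => e e0.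
have [n hn] : exists n, c%:R / e < n.+1%:R.
  exists (Num.bound (c%:R / e)); apply: (lt_trans (archi_boundP _)); last by rewrite ltr_nat.
  by rewrite divr_ge0 // ltW.
rewrite -leeBlDr //.
(* The lower limit is the supremum of the infima over tails, so it suffices to bound the tail where
   c/N is below e. *)
apply: le_trans (@ereal_sup_ubound _ _ (einfs u n.+1) _); last by exists n.+1.
apply: le_ereal_inf_tmp => _ [N /= nN <-]; rewrite -EFinB lee_fin.
have N0 : (0 < N)%N by apply: leq_trans nN.
apply: le_trans (prop_ge N N0); rewrite lerD2l lerN2.
rewrite ler_pdivrMr ?ltr0n // mulrC -ler_pdivrMr //.
by apply: (le_trans (ltW hn)); rewrite ler_nat.
Qed.

Lemma class_periodic n : [/\ zero_class (n + 1600 + 3) = zero_class (n + 3),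
  pos_class (n + 1600 + 3) = pos_class (n + 3) &
  neg_class (n + 1600 + 3) = neg_class (n + 3)].
Proof.
have e2 : odd (n + 1600 + 3) = odd (n + 3) by lia.
have e4 : ((n + 1600 + 3) %% 4 = (n + 3) %% 4)%N by lia.
have e8 : ((n + 1600 + 3) %% 8 = (n + 3) %% 8)%N by lia.
have e16 : ((n + 1600 + 3) %% 16 = (n + 3) %% 16)%N by lia.
have e64 : ((n + 1600 + 3) %% 64 = (n + 3) %% 64)%N by lia.
have e5 : ((n + 1600 + 3) %% 5 = (n + 3) %% 5)%N by lia.
have e25 : ((n + 1600 + 3) %% 25 = (n + 3) %% 25)%N by lia.
by rewrite /zero_class /pos_class /neg_class e2 e4 e8 e16 e64 e5 e25.
Qed.


Theorem corollary6 (R : realType) :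
  [/\ ((30 / 100 : R)%:E <= lower_density R (fun n => (bbar5 n == 0)%R))%E,
      ((52 / 100 : R)%:E <= lower_density R (fun n => (0 < bbar5 n)%R))%E
    & ((10 / 100 : R)%:E <= lower_density R (fun n => (bbar5 n < 0)%R))%E].
Proof.
have density (P : pred nat) (cls : nat -> bool) (d : nat) :
    (forall n, cls (n + 1600 + 3)%N = cls (n + 3)%N) ->
    (forall n, cls (n + 3)%N -> P n) ->
    (d * 1600 <= count (fun n => cls (n + 3)) (iota 0 1600) * 100)%N ->
    ((d%:R / 100%:R : R)%:E <= lower_density R P)%E.
  move=> cls_periodic clsP le_d.
  apply: le_trans (@lower_density_ge R P _ 1600 _ cls_periodic clsP) => //.
  rewrite lee_fin ler_pdivrMr ?ltr0n // mulrAC ler_pdivlMr ?ltr0n //.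
  by rewrite -!natrM ler_nat.
(* The counts over one period are 480, 840 and 166. *)
split.
- apply: (@density _ zero_class 30) => [n|n h|].
  + by have [] := class_periodic n.
  + by apply/eqP/bbar5_zero.
  + by vm_compute.
- apply: (@density _ pos_class 52) => [n|n h|].
  + by have [] := class_periodic n.
  + exact: bbar5_pos.
  + by vm_compute.
apply: (@density _ neg_class 10) => [n|n h|].
+ by have [] := class_periodic n.
+ exact: bbar5_neg.
+ by vm_compute.
Qed.
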